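(* Let $G$ and $G'$ be two even ring chains. Then $G$ and $G'$ are resonantly equivalent if and only if their resonance graphs $R(G)$ and $R(G')$ are isomorphic.
   Context: An even ring system is a simple bipartite 2-connected plane graph with all interior vertices of degree 3 and all boundary vertices of degree 2 or 3. The inner dual of an even ring system is the graph whose vertices are its inner faces, two being adjacent iff the faces share an edge. A catacondensed even ring system (CERS) is an even ring system whose inner dual is a tree; an even ring chain is an even ring system whose inner dual is a path. The resonance graph $R(G)$ of a CERS $G$ has as vertices the perfect matchings of $G$, two perfect matchings $M_1,M_2$ being adjacent iff their symmetric difference $M_1\oplus M_2$ is exactly the edge set of one inner face of $G$. If $F$ is an inner face and $F_0$ the outer face of a CERS $G$, a connected component of the graph induced by the edges in $E(F)\cap E(F_0)$ is called a boundary segment. Transformation 1: from a CERS $G$ and a boundary segment $P$ of $G$, obtain a CERS $G'$ by subdividing edges of $P$ an even number of times in total, or conversely by smoothing an even number of (degree-2) vertices of $P$. Two CERS $G$ and $H$ are resonantly equivalent if one can successively apply Transformation 1 to $G$ and to $H$ to obtain graphs $G'$ and $H'$ that are isomorphic. *)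

(* Defs.v *)
From mathcomp Require Import all_boot.
From Stdlib Require Import Relations.

Set Implicit Arguments.
Unset Strict Implicit.
Unset Printing Implicit Defensive.

(* Plane graphs as combinatorial maps (rotation systems) with a             *)
(* distinguished outer face.                                                *)
(*  - dart   : finite type of darts (half-edges / oriented edges);          *)
(*  - edge   : the reversal involution (d : u -> v  |->  edge d : v -> u);  *)
(*  - node   : the rotation around the tail vertex of a dart (a permutation)*)
(*  - vertices = orbits of node, edges = orbits of edge,                    *)
(*    faces    = orbits of face := node \o edge;                            *)
(*  - outer  : a dart lying on the outer face F0.                           *)
(* Planarity (genus 0) is expressed by connectivity + Euler's formula       *)
(*   V - E + F = 2, i.e. 2 (V + F) = #darts + 4.                            *)

Record cmap := PMap {
  dart : finType;
  edge : dart -> dart;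
  node : dart -> dart;
  outer : dart
}.

Section PlaneMap.
Variable m : cmap.
Local Notation D := (dart m).

Definition face (d : D) : D := @node m (@edge m d).

Definition same_vertex (d e : D) : bool := fconnect (@node m) d e.
Definition same_face (d e : D) : bool := fconnect face d e.
Definition deg (d : D) : nat := fingraph.order (@node m) d.

Definition on_outer (d : D) : bool := same_face (outer m) d.
Definition boundary_vertex (d : D) : bool :=
  [exists e, same_vertex d e && on_outer e].

Definition adj_dart (d e : D) : bool := (e == @edge m d) || (e == @node m d).

Definition map_connected : Prop := forall d e : D, connect adj_dart d e.

Definition plane_map : Prop :=
  [/\ forall d, @edge m (@edge m d) = d,
      forall d, @edge m d != d,
      injective (@node m),
      map_connected &
      2 * (fcard (@node m) D + fcard face D) = #|D| + 4].

Definition simple_map : Prop :=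
  (forall d, ~~ same_vertex d (@edge m d)) /\
  (forall d e, same_vertex d e -> same_vertex (@edge m d) (@edge m e) -> d = e).

Definition bipartite_map : Prop :=
  exists c : D -> bool,
    (forall d e, same_vertex d e -> c d = c e) /\ (forall d, c (@edge m d) != c d).

Definition adj_dart_avoid (x : D) (d e : D) : bool :=
  [&& adj_dart d e, ~~ same_vertex x d & ~~ same_vertex x e].

Definition two_connected : Prop :=
  [/\ 3 <= fcard (@node m) D,
      map_connected &
      forall x d e : D, ~~ same_vertex x d -> ~~ same_vertex x e ->
        connect (adj_dart_avoid x) d e].

Definition even_ring_system : Prop :=
  [/\ plane_map, simple_map, bipartite_map & two_connected] /\
  (forall d, ~~ boundary_vertex d -> deg d = 3) /\
  (forall d, boundary_vertex d -> (deg d == 2) || (deg d == 3)).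

Definition inner_face_rep (d : D) : bool := (froot face d == d) && ~~ on_outer d.
Definition inner_face := {d : D | inner_face_rep d}.

Definition dual_adj (a b : inner_face) : bool :=
  (a != b) && [exists x : D, same_face (val a) x && same_face (val b) (@edge m x)].

Definition dual_is_tree : Prop :=
  (forall a b : inner_face, connect dual_adj a b) /\
  ~ (exists s : seq inner_face, [/\ uniq s, 3 <= size s & cycle dual_adj s]).

Definition dual_is_path : Prop :=
  exists s : seq inner_face,
    [/\ uniq s, 0 < size s, (forall a, a \in s) &
        forall i j, i < size s -> j < size s ->
          forall a0 : inner_face,
          dual_adj (nth a0 s i) (nth a0 s j) = (i == j.+1) || (j == i.+1)].

Definition face_edges (f : D) : {set D} :=
  [set d | same_face f d || same_face f (@edge m d)].

Definition perfect_matching (M : {set D}) : bool :=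
  [forall d, (@edge m d \in M) == (d \in M)] &&
  [forall d, #|[set e in M | same_vertex d e]| == 1].

Definition res_vertex := {M : {set D} | perfect_matching M}.

Definition symdiff (A B : {set D}) : {set D} := (A :\: B) :|: (B :\: A).

Definition res_adj (M1 M2 : res_vertex) : bool :=
  [exists f : D, ~~ on_outer f && (symdiff (val M1) (val M2) == face_edges f)].

End PlaneMap.

Definition CERS (m : cmap) : Prop := even_ring_system m /\ dual_is_tree m.
Definition even_ring_chain (m : cmap) : Prop := even_ring_system m /\ dual_is_path m.

Definition graph_iso (T1 T2 : finType) (r1 : rel T1) (r2 : rel T2) : Prop :=
  exists f : T1 -> T2, bijective f /\ forall x y, r2 (f x) (f y) = r1 x y.

Definition resonance_iso (m1 m2 : cmap) : Prop :=
  graph_iso (@res_adj m1) (@res_adj m2).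

Definition underlying_iso (m1 m2 : cmap) : Prop :=
  exists f : dart m1 -> dart m2,
    [/\ bijective f, forall d, f (@edge m1 d) = @edge m2 (f d) &
        forall d e, @same_vertex m2 (f d) (f e) = @same_vertex m1 d e].

Definition map_iso (m1 m2 : cmap) : Prop :=
  exists f : dart m1 -> dart m2,
    [/\ bijective f, forall d, f (@edge m1 d) = @edge m2 (f d),
        forall d, f (@node m1 d) = @node m2 (f d) &
        @on_outer m2 (f (outer m1))].

(* Subdividing the edge {d0, edge d0} (from u to v) twice: new vertices     *)
(* x, y and path u - x - y - v.  New darts: inr 0 : x->u, inr 1 : x->y,     *)
(* inr 2 : y->x, inr 3 : y->v; inl d0 becomes u->x, inl (edge d0) v->y.     *)
Definition i4 (k : nat) : 'I_4 := inord k.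

Section Subdiv.
Variables (m : cmap) (d0 : dart m).
Local Notation D := (dart m).

Definition sd_edge (z : D + 'I_4) : D + 'I_4 :=
  match z with
  | inl d => if d == d0 then inr (i4 0)
             else if d == @edge m d0 then inr (i4 3) else inl (@edge m d)
  | inr i => match nat_of_ord i with
             | 0 => inl d0 | 1 => inr (i4 2) | 2 => inr (i4 1)
             | _ => inl (@edge m d0) end
  end.

Definition sd_node (z : D + 'I_4) : D + 'I_4 :=
  match z with
  | inl d => inl (@node m d)
  | inr i => match nat_of_ord i with
             | 0 => inr (i4 1) | 1 => inr (i4 0) | 2 => inr (i4 3)
             | _ => inr (i4 2) end
  end.

Definition subdiv2 : cmap := @PMap (D + 'I_4)%type sd_edge sd_node (inl (outer m)).
End Subdiv.

(* d0 is a dart of an edge lying in a boundary segment, i.e. in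
   E(F) \cap E(F0) for an inner face F and the outer face F0 *)
Definition boundary_segment_dart (m : cmap) (d : dart m) : bool :=
  (@on_outer m d && ~~ @on_outer m (@edge m d)) ||
  (@on_outer m (@edge m d) && ~~ @on_outer m d).

(* One application of Transformation 1 (up to plane-map isomorphism):
   subdividing edges of a boundary segment an even number of times amounts
   (up to isomorphism) to repeatedly subdividing one of its edges twice;
   smoothing is the converse operation. Source and result are CERS. *)
Definition transformation1 (G H : cmap) : Prop :=
  [/\ CERS G, CERS H &
      (exists d, @boundary_segment_dart G d /\ map_iso (@subdiv2 G d) H) \/
      (exists d, @boundary_segment_dart H d /\ map_iso (@subdiv2 H d) G)].

Definition resonantly_equivalent (G H : cmap) : Prop :=
  exists G' H', [/\ clos_refl_trans cmap transformation1 G G',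
                    clos_refl_trans cmap transformation1 H H' &
                    underlying_iso G' H'].

(* Main.v *)
Require Import Defs.
From mathcomp Require Import all_boot ssralg matrix mxalgebra zify.
From Stdlib Require Import Relations.

(* By Euler's formula, the cut space and the face space of a plane map are
   orthogonal complements over F_2. For a catacondensed system this gives: all
   vertices lie on the outer face, both sides of an edge are different faces,
   and two inner faces share at most one edge.

   For the forward implication, a perfect matching extends uniquely along a
   double subdivision, and abstract isomorphisms preserve inner faces because
   these are minimal chordless even edge sets.

   For the converse, fix the perfect matching M0 made of alternate outer edges.
   Every perfect matching is M0 + (boundary of g) for a unique set g of inner
   faces, and the edge shared by consecutive faces f_i, f_(i+1) of the chain
   forbids exactly one of the four values of (g f_i, g f_(i+1)). So R(G) is the
   graph of up-sets of a zigzag poset. Its isomorphisms are Hamming isometries,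
   hence signed permutations of the coordinates, which respect the covering
   relation of the poset; so the zigzag pattern is determined up to reversal.
   The pattern records the parities of the distances between consecutive shared
   edges, and chains with equal parities become isomorphic after subdividing
   every segment up to a common length. *)

Set Implicit Arguments.
Unset Strict Implicit.
Unset Printing Implicit Defensive.

(** * Duality of cuts and faces over F_2 *)

Import GRing.Theory.

(** Combinatorial maps carry no topology, so arguments that would use the Jordan curve theorem
    become a dimension count: by connectivity the vertex-edge and face-edge incidence matrices have
    ranks at least V-1 and F-1, and Euler's formula leaves no room for larger ranks. Local questions
    stay finite because every vertex of a catacondensed system has exactly one outer corner and one
    or two inner ones. The resonance graph shows the zigzag only up to complementing all words and
    reversing the chain. What survives is whether consecutive signs are equal, and this is the
    parity of the distance between the two shared edges of a middle face. An end face has at most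
    one shared edge; its missing dart is placed so that the distance is even, which makes the
    parities of two chains comparable everywhere. Faces have even length, so both arcs between the
    marked darts of a face have the same parity, and reversing a chain, which exchanges the arcs,
    does no harm. *)

Section CutDuality.
Variables (T : finType) (e : T -> T).
Hypotheses (eK : involutive e) (e_neq : forall x, e x != x).

(** One dart from each edge; these index the coordinates of the edge space over F_2. *)
Let A : {set T} := [set x | enum_rank x < enum_rank (e x)].

Let A_e x : (e x \in A) = (x \notin A).
Proof.
rewrite !inE eK -leqNgt [RHS]leq_eqVlt; case: eqP => // h0; have h := enum_rank_inj (ord_inj h0).
by have := e_neq x; rewrite h eqxx.
Qed.

Let card_A : #|A|.*2 = #|T|.
Proof.
rewrite -(cardC A) -addnn; congr (_ + _).
rewrite -(card_imset (mem A) (inv_inj eK)); apply: eq_card => x.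
apply/imsetP/idP => [[y yA ->]|].
  by rewrite [e y \in _]inE /= A_e negbK.
by rewrite [x \in _]inE => xA; exists (e x); rewrite ?eK ?A_e.
Qed.

Let sum_A (F : T -> bool) : (\sum_x F x = \sum_(x in A) (F x + F (e x)))%R.
Proof.
rewrite big_split [LHS](bigID (mem A)) /=; congr (_ + _)%R.
rewrite (reindex_inj (inv_inj eK)) /=; apply: eq_bigl => x.
by rewrite A_e negbK.
Qed.

Let rt (p : T -> T) : pred T := froots p.
(** Incidence matrix of the orbits of [p] against the edges, meant for vertices and faces alike; an
    edge with both darts in one orbit contributes 0. *)
Let inc (p : T -> T) : 'M[bool]_(#|rt p|, #|A|) :=
  \matrix_(i, j) (fconnect p (enum_val i) (enum_val j)
              (+) fconnect p (enum_val i) (e (enum_val j))).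

Let ext (p : T -> T) (u : 'rV[bool]_(#|rt p|)) (x : T) : bool :=
  (\sum_i u ord0 i * (fconnect p (enum_val i) x : bool))%R.

Let ext_inv p u x : injective p -> ext u (p x) = ext (p := p) u x.
Proof.
by move=> p_inj; apply: eq_bigr => i _; rewrite -same_fconnect1_r.
Qed.

Let ext_val p u i : injective p -> ext (p := p) u (enum_val i) = u ord0 i.
Proof.
move=> p_inj; rewrite /ext (bigD1 i) //= connect0 mulr1 big1 ?addr0 // => k ki.
case: (boolP (fconnect _ _ _)) => [/(rootP (fconnect_sym p_inj))|]; last by rewrite mulr0.
have:= enum_valP k; have:= enum_valP i.
rewrite ![_ \in rt _]/(froots p _ : bool) /roots => /eqP-> /eqP-> /enum_val_inj h.
by rewrite h eqxx in ki.
Qed.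

Let mul_inc p u j :
  (u *m inc p)%R ord0 j = ext u (enum_val j) (+) ext u (e (enum_val j)).
Proof.
rewrite mxE -[RHS]big_split /=; apply: eq_bigr => i _.
by rewrite mxE; case: (u ord0 i).
Qed.

(** A row vector in the left kernel is a function on orbits that agrees across every edge, hence a
    constant by connectivity; so the kernel has dimension at most 1. *)
Let rank_inc p : injective p ->
  (forall c : T -> bool, (forall x, c (p x) = c x) -> (forall x, c (e x) = c x) ->
     forall x y, c x = c y) ->
  #|rt p| <= (\rank (inc p)).+1.
Proof.
move=> p_inj conn.
suff: (kermx (inc p) <= (const_mx true : 'rV[bool]_(#|rt p|)))%MS.
  move/mxrankS; rewrite mxrank_ker leq_subLR => h; apply: leq_trans h _.
  by rewrite -(addn1 (\rank (inc p))) leq_add2l rank_leq_row.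
apply/row_subP => i; set u := row i _.
have: (u *m inc p = 0)%R by apply/eqP; rewrite -[_ == _]sub_kermx row_sub.
move: u => u u0.
have inv : forall x, ext u (e x) = ext u x.
  have h x : x \in A -> ext u (e x) = ext u x.
    move=> xA; have:= mul_inc u (enum_rank_in xA x).
    by rewrite u0 mxE enum_rankK_in //; do 2!case: (ext u _).
  move=> x; case: (boolP (x \in A)) => [/h//|]; rewrite -A_e => /h.
  by rewrite eK.
have cst := conn _ (fun x => ext_inv u x p_inj) inv.
case: (pickP (rt p)) => [x0 _|none].
  suff ->: u = (ext u x0 *: const_mx true)%R by rewrite scalemx_sub.
  by apply/rowP => k; rewrite !mxE mulr1 -(ext_val u k p_inj); apply: cst.
suff ->: u = 0%R by rewrite sub0mx.
by apply/rowP => k; have := none (enum_val k); rewrite (enum_valP k : rt p _).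
Qed.

(* Cuts are orthogonal to face boundaries, and by Euler's formula the two
   F_2-spaces have complementary dimensions in the edge space. *)
Lemma even_cut (p q : T -> T) : injective p -> injective q ->
  (forall x, q (e x) = p x) ->
  (forall c : T -> bool, (forall x, c (p x) = c x) -> (forall x, c (e x) = c x) ->
     forall x y, c x = c y) ->
  2 * (fcard p T + fcard q T) = #|T| + 4 ->
  forall s : T -> bool, (forall x, s (e x) = s x) ->
  (forall x, \big[addb/false]_(y | fconnect q x y) s y = false) ->
  exists c : T -> bool, (forall x, c (p x) = c x) /\
                        forall x, s x = c x (+) c (e x).
Proof.
move=> p_inj q_inj qe conn euler.
have fcE f : fcard f T = #|rt f|.
  by apply: eq_card => x; rewrite !inE andbT.
have conn' : forall c : T -> bool, (forall x, c (q x) = c x) ->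
    (forall x, c (e x) = c x) -> forall x y, c x = c y.
  by move=> c c1 c2; apply: conn => // x; rewrite -qe c1 c2.
have rp := rank_inc p_inj conn; have rq := rank_inc q_inj conn'.
pose row_of (s : T -> bool) : 'rV[bool]_#|A| := (\row_j s (enum_val j))%R.
have mulT (s : T -> bool) : (forall x, s (e x) = s x) ->
    (forall x, \big[addb/false]_(y | fconnect q x y) s y = false) ->
    (row_of s *m (inc q)^T = 0)%R.
  move=> se s0; apply/rowP => f; rewrite !mxE -[RHS](s0 (enum_val f)).
  rewrite [RHS]big_mkcond [RHS]sum_A [RHS]big_enum_val /=; apply: eq_bigr => j _.
  rewrite !mxE se; do 2!case: (fconnect q (enum_val f) _);
  by case: (s _).
have incE i : row i (inc p) = row_of (fun x => fconnect p (enum_val i) x (+)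
                fconnect p (enum_val i) (e x)).
  by apply/rowP => j; rewrite !mxE.
(* The cut around an orbit of [p] meets every orbit of [q] evenly: [e y] and [q y] lie in one orbit
   of [p], so reindexing by [q] makes the two halves of the sum cancel. *)
have orth : (inc p <= kermx (inc q)^T)%MS.
  apply/row_subP => i; rewrite incE; apply/sub_kermxP; apply: mulT => [x|x].
    by rewrite eK addbC.
  rewrite big_split /= [X in _ (+) X](_ : _ = \big[addb/false]_(y | fconnect q x y)
     fconnect p (enum_val i) y) ?addbb //.
  rewrite [RHS](reindex_inj q_inj) /=; apply: eq_big => [y|y _].
    by rewrite -same_fconnect1_r.
  by rewrite -{2}[y]eK qe -same_fconnect1_r.
(* With V and F the numbers of orbits of [p] and [q], the kernel has dimension at most [#|A|] -
   (F-1) = V-1, which the rank of [inc p] reaches; so the inclusion [orth] is an equality. *)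
have keq : (kermx (inc q)^T <= inc p)%MS.
  rewrite -(geq_leqif (mxrank_leqif_sup orth)) mxrank_ker mxrank_tr leq_subLR.
  move: euler; rewrite !fcE -card_A -mul2n => euler.
  by move: rp rq; lia.
move=> s se s0.
have /submxP[u uE] : (row_of s <= inc p)%MS.
  by apply: submx_trans keq; apply/sub_kermxP; apply: mulT.
exists (ext u); split=> [x|]; first exact: ext_inv.
have h x : x \in A -> s x = ext u x (+) ext u (e x).
  move=> xA; have:= mul_inc u (enum_rank_in xA x).
  by rewrite -uE mxE enum_rankK_in.
move=> x; case: (boolP (x \in A)) => [/h//|]; rewrite -A_e => /h.
by rewrite eK se addbC.
Qed.
End CutDuality.

(** * Plane maps and catacondensed systems *)

Lemma fconnect_const (T : finType) (U : eqType) (f : T -> T) (k : T -> U) :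
  (forall x, k (f x) = k x) -> forall x y, fconnect f x y -> k x = k y.
Proof. by move=> h; apply: fconnect_invariant => x; rewrite /= h eqxx. Qed.

Lemma big_addb_pred1 (T : finType) (P : pred T) (a : T) :
  \big[addb/false]_(y | P y) (y == a) = P a.
Proof.
rewrite big_mkcond (bigD1 a) //= eqxx big1 ?addbF; first by case: (P a).
by move=> i /negbTE ->; case: (P i).
Qed.

Section PlaneMaps.
Variable m : cmap.
Hypothesis pm : plane_map m.
Local Notation D := (dart m).
Implicit Types (d x y : D).

Lemma edgeK : involutive (@edge m). Proof. by case: pm. Qed.
Lemma edge_inj : injective (@edge m). Proof. exact: inv_inj edgeK. Qed.
Lemma edge_neq d : edge d != d. Proof. by case: pm. Qed.
Lemma node_inj : injective (@node m). Proof. by case: pm. Qed.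
Lemma face_inj : injective (@face m).
Proof. by move=> x y /node_inj/edge_inj. Qed.
Lemma face_edge d : face (edge d) = node d.
Proof. by rewrite /face edgeK. Qed.

Lemma same_face_refl d : same_face d d. Proof. exact: connect0. Qed.
Lemma same_face_sym x y : same_face x y = same_face y x.
Proof. exact: fconnect_sym face_inj _ _. Qed.
Lemma same_face_trans x y z : same_face x y -> same_face y z -> same_face x z.
Proof. exact: connect_trans. Qed.
Lemma same_face_l x y : same_face x y -> same_face x =1 same_face y.
Proof. by apply: same_connect; apply: fconnect_sym face_inj. Qed.
Lemma same_face_r x y z : same_face x y -> same_face z x = same_face z y.
Proof. by move=> h; rewrite same_face_sym (same_face_l h) same_face_sym. Qed.
Lemma same_face1 d : same_face d (face d). Proof. exact: fconnect1. Qed.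
Lemma same_face_node d : same_face (edge d) (node d).
Proof. by rewrite -face_edge same_face1. Qed.

Lemma same_vertex_refl d : same_vertex d d. Proof. exact: connect0. Qed.
Lemma same_vertex_sym x y : same_vertex x y = same_vertex y x.
Proof. exact: fconnect_sym node_inj _ _. Qed.
Lemma same_vertex_trans x y z :
  same_vertex x y -> same_vertex y z -> same_vertex x z.
Proof. exact: connect_trans. Qed.
Lemma same_vertex1 d : same_vertex d (node d). Proof. exact: fconnect1. Qed.

Lemma on_outer_face d : on_outer (face d) = on_outer d.
Proof. by rewrite /on_outer -(same_face_r _ (same_face1 d)). Qed.
Lemma on_outer_edge d : on_outer (edge d) = on_outer (node d).
Proof. by rewrite -face_edge on_outer_face. Qed.
Lemma on_outer_same x y : same_face x y -> on_outer x = on_outer y.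
Proof. exact: same_face_r. Qed.
Lemma on_outer2 x y : on_outer x -> on_outer y -> same_face x y.
Proof. by rewrite /on_outer same_face_sym; apply: same_face_trans. Qed.

Lemma connected_const (c : D -> bool) :
  (forall x, c (node x) = c x) -> (forall x, c (edge x) = c x) ->
  forall x y, c x = c y.
Proof.
move=> cn ce x y; case: pm => _ _ _ /(_ x y) /connectP [p + ->] _.
elim: p x => //= z p IH x /andP[h /IH <-].
by case/orP: h => /eqP->.
Qed.

Lemma connected_const_face (c : D -> bool) :
  (forall x, c (face x) = c x) -> (forall x, c (edge x) = c x) ->
  forall x y, c x = c y.
Proof.
by move=> cf ce; apply: connected_const => // x; rewrite -face_edge cf ce.
Qed.

Lemma cut_of_face_even (s : D -> bool) :
  (forall x, s (edge x) = s x) ->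
  (forall x, \big[addb/false]_(y | same_face x y) s y = false) ->
  exists c : D -> bool, (forall x, c (node x) = c x) /\
                        forall x, s x = c x (+) c (edge x).
Proof.
apply: (even_cut edgeK edge_neq node_inj face_inj face_edge connected_const).
by case: pm.
Qed.

(** Since [edge] is an involution, [node] is also [face] after [edge], so the same duality applies
    with the two permutations exchanged. *)
Lemma face_sum_of_vertex_even (s : D -> bool) :
  (forall x, s (edge x) = s x) ->
  (forall x, \big[addb/false]_(y | same_vertex x y) s y = false) ->
  exists g : D -> bool, (forall x, g (face x) = g x) /\
                        forall x, s x = g x (+) g (edge x).
Proof.
apply: (even_cut edgeK edge_neq face_inj node_inj _ connected_const_face) => //.
by case: pm => _ _ _ _; rewrite addnC.
Qed.

End PlaneMaps.

(** * Corners and sides of edges in an even ring system *)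

Section EvenRing.
Variable m : cmap.
Hypothesis ers : even_ring_system m.
Local Notation D := (dart m).
Implicit Types (d x y : D).

Lemma ers_plane : plane_map m. Proof. by case: ers => -[]. Qed.
Let pm := ers_plane.

Lemma deg23 d : deg d = 2 \/ deg d = 3.
Proof.
case: ers => _ [h3 h2]; case: (boolP (boundary_vertex d)) => [/h2|/h3]; last by right.
by case/orP => /eqP; [left | right].
Qed.

Lemma iter_deg d : iter (deg d) (@node m) d = d.
Proof. exact: iter_order (node_inj pm) d. Qed.

Lemma same_vertexE x y : same_vertex x y = (y \in traject (@node m) x (deg x)).
Proof. exact: fconnect_orbit. Qed.

Lemma same_vertex3 x y : same_vertex x y -> [\/ y = x, y = node x | y = node (node x)].
Proof.
rewrite same_vertexE; case: (deg23 x) => ->; rewrite !inE.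
  by case/orP => /eqP->; [apply: Or31|apply: Or32].
by case/or3P => /eqP->; [apply: Or31|apply: Or32|apply: Or33].
Qed.

Lemma node_neq d : node d != d.
Proof.
apply/eqP => h; have: uniq (traject (@node m) d (deg d)) by exact: orbit_uniq.
by case: (deg23 d) => ->; rewrite /= h !inE eqxx.
Qed.

Lemma node_order3 d : node (node d) != d -> node (node (node d)) = d.
Proof. by case: (deg23 d) (iter_deg d) => -> /= -> //; rewrite eqxx. Qed.

Lemma same_vertex_edge d : ~~ same_vertex d (edge d).
Proof. by case: ers => -[_ [h _]]. Qed.

Lemma simple_eq x y :
  same_vertex x y -> same_vertex (edge x) (edge y) -> x = y.
Proof. by case: ers => -[_ [_ h]] _ _ _; apply: h. Qed.

(* An edge with the same face on both sides would be a bridge, by duality. *)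
Lemma same_face_edge d : ~~ same_face d (edge d).
Proof.
apply/negP => dd.
pose s x := (x == d) (+) (x == edge d).
have [|x|c [cn cs]] := @cut_of_face_even m pm s.
- by move=> x; rewrite /s addbC !(inv_eq (edgeK pm)) (edgeK pm).
- rewrite big_split /= !big_addb_pred1 (same_face_sym pm) (same_face_l pm dd).
  by rewrite -(same_face_sym pm) addbb.
have sd : c d != c (edge d).
  by have := cs d; rewrite /s eqxx eq_sym (negbTE (edge_neq pm d)); do 2!case: (c _).
have ed_d x : same_vertex d x -> x != edge d.
  by move=> h; apply: contraTneq h => ->; exact: same_vertex_edge.
case: ers => -[_ _ _ [_ _ tc] _].
have h1 : ~~ same_vertex d (edge (node d)).
  apply: contra (same_vertex_edge (node d)) => h.
  by apply: same_vertex_trans h; rewrite (same_vertex_sym pm) same_vertex1.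
(* This path joins another neighbour of the tail of [d] to the head of [d] and avoids that tail, so
   it never crosses the edge of [d], the only edge along which [c] changes. *)
have /connectP[p pp pl] := tc _ _ _ h1 (same_vertex_edge d).
have c2 : c (edge (node d)) = c d.
  have := cs (node d); rewrite /s (negbTE (node_neq d)) (negbTE (ed_d _ (same_vertex1 d))).
  by rewrite cn; do 2!case: (c _).
suff h : forall a, path (adj_dart_avoid d) a p -> c (last a p) = c a.
  by rewrite -c2 -(h _ pp) -pl eqxx in sd.
elim: p {pp pl} => //= b p IH a /andP[/and3P[ab na nb] /IH->].
case/orP: ab => /eqP bE; rewrite bE ?cn //.
have := cs a; rewrite /s; case: eqP => [ad|_]; first by rewrite ad same_vertex_refl in na.
case: eqP => [ad|_]; first by rewrite bE ad (edgeK pm) same_vertex_refl in nb.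
by do 2!case: (c _).
Qed.

(** The faces at consecutive corners [x] and [node x] are the two sides of the edge of [x], and
    among at most three corners any two distinct ones are consecutive in some order. *)
Lemma corner_inj x y : same_vertex x y -> same_face x y -> x = y.
Proof.
move=> v f; have := v; case/same_vertex3 => yE; first by [].
  case/negP: (same_face_edge x); rewrite (same_face_sym pm).
  by rewrite (same_face_l pm (same_face_node pm x)) -yE (same_face_sym pm).
case: (eqVneq (node (node x)) x) => [<-|/node_order3 h]; first by rewrite yE.
case/negP: (same_face_edge y); rewrite (same_face_sym pm).
by rewrite (same_face_l pm (same_face_node pm y)) yE h -yE.
Qed.

Lemma outer_corner_inj x y : same_vertex x y -> on_outer x -> on_outer y -> x = y.
Proof. by move=> h hx hy; apply: corner_inj h _; apply: on_outer2. Qed.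

Lemma on_outer_edgeN d : on_outer d -> ~~ on_outer (edge d).
Proof.
by move=> hd; apply: contra (same_face_edge d) => he; apply: on_outer2.
Qed.

End EvenRing.

Section InnerFaces.
Variable m : cmap.
Hypothesis pm : plane_map m.
Local Notation D := (dart m).

Lemma face_of_subproof (x : D) : ~~ on_outer x -> inner_face_rep (froot (@face m) x).
Proof.
move=> hx; rewrite /inner_face_rep root_root ?eqxx; last exact: fconnect_sym (face_inj pm).
by rewrite -(on_outer_same pm (connect_root _ x)).
Qed.

Definition face_of (x : D) (hx : ~~ on_outer x) : inner_face m :=
  Sub (froot (@face m) x) (face_of_subproof hx).

Lemma same_face_of x hx : same_face x (val (@face_of x hx)).
Proof. exact: connect_root. Qed.

Lemma inner_face_eq (a b : inner_face m) : (a == b) = same_face (val a) (val b).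
Proof.
rewrite -val_eqE /=; case: a b => [a /= /andP[/eqP <- _]] [b /= /andP[/eqP <- _]].
have sy := fconnect_sym (face_inj pm).
by rewrite root_connect // /same_face -(same_connect sy (connect_root _ a))
  -(same_connect_r sy (connect_root _ b)).
Qed.

Lemma inner_face_outer (a : inner_face m) : ~~ on_outer (val a).
Proof. by case: a => [a /= /andP[]]. Qed.

Lemma face_of_eq x y hx hy : (@face_of x hx == @face_of y hy) = same_face x y.
Proof.
rewrite inner_face_eq (same_face_l pm (same_face_of hx)).
by rewrite (same_face_r pm _ (same_face_of hy)).
Qed.

Lemma dual_adjP (a b : inner_face m) : dual_adj a b ->
  exists x, [/\ same_face (val a) x, same_face (val b) (edge x) & a != b].
Proof. by case/andP => ? /existsP[x /andP[? ?]]; exists x. Qed.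

Lemma dual_adjI (a b : inner_face m) x : a != b ->
  same_face (val a) x -> same_face (val b) (edge x) -> dual_adj a b.
Proof. by move=> ab ax bx; rewrite /dual_adj ab; apply/existsP; exists x; rewrite ax. Qed.

Lemma dual_adj_sym (a b : inner_face m) : dual_adj a b = dual_adj b a.
Proof.
by apply/idP/idP => /dual_adjP[x [? ? ?]]; apply: (@dual_adjI _ _ (edge x));
  rewrite ?(edgeK pm) // eq_sym.
Qed.

End InnerFaces.

(** * Consequences of the inner dual being a tree *)

Section Cers.
Variable m : cmap.
Hypotheses (ers : even_ring_system m) (dt : dual_is_tree m).
Let pm := ers_plane ers.
Local Notation D := (dart m).

(* Three inner faces around a vertex would form a triangle in the inner dual. *)
Lemma all_boundary (d : D) : boundary_vertex d.
Proof.
apply: contraT => nb; have d3 : deg d = 3 by case: ers => _ [h _]; apply: h.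
have no x : same_vertex d x -> ~~ on_outer x.
  by move=> dx; apply: contra nb => ox; apply/existsP; exists x; rewrite dx.
have n3 : node (node (node d)) = d by rewrite -[RHS](iter_deg ers) d3.
have v1 := same_vertex1 d; have v2 := same_vertex_trans v1 (same_vertex1 _).
have h0 := no _ (same_vertex_refl d); have h1 := no _ v1; have h2 := no _ v2.
have adj x y hx hy : y = node x -> dual_adj (face_of pm (x := x) hx) (face_of pm (x := y) hy).
  move=> yE; apply: (dual_adjI (x := x)).
  - by rewrite face_of_eq yE -(same_face_r pm _ (same_face_node pm x)) same_face_edge.
  - by rewrite (same_face_sym pm) same_face_of.
  - rewrite (same_face_sym pm) (same_face_l pm (same_face_node pm x)) -yE.
    exact: same_face_of.
case: dt => _; case; exists [:: face_of pm h0; face_of pm h1; face_of pm h2].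
have a01 := adj _ _ h0 h1 erefl; have a12 := adj _ _ h1 h2 erefl.
have a20 := adj _ _ h2 h0 (esym n3).
split => //; last by rewrite /= a01 a12 a20.
move: a01 a12 a20 => /andP[h01 _] /andP[h12 _] /andP[h20 _].
by rewrite /= !inE negb_or h01 h12 eq_sym h20.
Qed.

Lemma outer_corner (d : D) :
  [|| on_outer d, on_outer (node d) | on_outer (node (node d))].
Proof.
case/existsP: (all_boundary d) => x /andP[/(same_vertex3 ers) []-> ->] //;
by rewrite ?orbT.
Qed.

(* Two edges shared by two faces would form a cut separating some vertex
   from the outer face. *)
Lemma shared_edge_uniq (x y : D) : ~~ on_outer x -> ~~ on_outer (edge x) ->
  same_face x y -> same_face (edge x) (edge y) -> x = y.
Proof.
move=> ox oex xy exy; apply/eqP; apply: contraT => nxy.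
pose s z := ((z == x) (+) (z == edge x)) (+) ((z == y) (+) (z == edge y)).
have [z|z|c [cn cs]] := @cut_of_face_even m pm s.
- rewrite /s [(edge z == x) (+) _]addbC [(edge z == y) (+) _]addbC.
  by rewrite !(inv_eq (edgeK pm)) !(edgeK pm).
- rewrite !big_split /= !big_addb_pred1 -(same_face_r pm _ xy) -(same_face_r pm _ exy).
  by rewrite addbb.
have cv u v : same_vertex u v -> c u = c v by apply: fconnect_const.
have sx : c x != c (edge x).
  have := cs x; rewrite /s eqxx (negbTE nxy) eq_sym (negbTE (edge_neq pm x)).
  have: x != edge y.
    apply: contraNneq (same_face_edge ers y) => xE.
    by rewrite -xE (same_face_sym pm).
  by move/negbTE=> ->; do 2!case: (c _).
(* Neither of the two edges is on the outer face, so [c] is constant along that face; every vertex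
   has a corner there. *)
have co z : on_outer z -> c z = c (outer m).
  have sF w : on_outer w -> s w = false.
    move=> ow; rewrite /s; have no w' : ~~ on_outer w' -> (w == w') = false.
      by move=> ow'; apply: contraNF ow' => /eqP <-.
    by rewrite !no // -?(on_outer_same pm xy) -?(on_outer_same pm exy).
  move=> oz; have: same_face (outer m) z by [].
  have h w : on_outer w -> c (face w) = c w.
    by move=> ow; rewrite cn; have := cs w; rewrite sF //; do 2!case: (c _).
  case/connectP=> p pp ->; elim/last_ind: p pp {oz} => //= p w IH.
  rewrite rcons_path last_rcons => /andP[pp /eqP <-].
  rewrite h ?IH //; apply/connectP; by exists p.
have cz (z : D) : c z = c (outer m).
  by case/existsP: (all_boundary z) => w /andP[zw ow]; rewrite (cv _ _ zw) co.
by rewrite !cz eqxx in sx.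
Qed.

End Cers.

(** For acyclicity, consider the face of least index on a cycle: both of its neighbours there have
    the next index, so they coincide. *)
Lemma path_dual_is_tree m : plane_map m -> dual_is_path m -> dual_is_tree m.
Proof.
move=> pm [s [us s0 alls sadj]]; split.
  have adj a b : dual_adj a b = (index a s == (index b s).+1) || (index b s == (index a s).+1).
    by rewrite -(sadj _ _ _ _ a) ?index_mem // !nth_index.
  have sy : connect_sym (@dual_adj m).
    by apply: sym_connect_sym => x y; apply: dual_adj_sym.
  move=> a0 b0; set r := nth a0 s 0.
  suff h i : i < size s -> connect (@dual_adj m) r (nth a0 s i).
    apply: (connect_trans (y := r)); first rewrite sy.
      by rewrite -(nth_index a0 (alls a0)) h // index_mem.
    by rewrite -(nth_index a0 (alls b0)) h // index_mem.
  elim: i => [|i IH] hi; first exact: connect0.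
  apply: connect_trans (IH (ltnW hi)) (connect1 _).
  by rewrite (sadj _ _ (ltnW hi) hi a0) eqxx orbT.
case=> t [ut t3 ct].
have a0 : inner_face m by case: t t3 {ut ct} => [|a t].
have adj a b : dual_adj a b = (index a s == (index b s).+1) || (index b s == (index a s).+1).
  by rewrite -(sadj _ _ _ _ a) ?index_mem // !nth_index.
have ii a b : index a s = index b s -> a = b.
  by move=> h; rewrite -(nth_index a0 (alls a)) h nth_index.
have ta : head a0 t \in t by case: t t3 {ut ct} => [|a t] //=; rewrite mem_head.
have [x xt xmin] : exists2 x, x \in t & forall y, y \in t -> index x s <= index y s.
  case: (@arg_minnP _ (head a0 t) [in t] (index^~ s)) => // x xt h.
  by exists x.
case/rot_to: xt (xt) => i t' rE xt.
move: ct ut t3; rewrite -(rot_cycle i) -(rot_uniq i) -(size_rot i) rE /=.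
have mem_t y : y \in x :: t' -> index x s <= index y s.
  by rewrite -rE mem_rot; apply: xmin.
case: t' rE mem_t => [|b [|c t']] // rE mem_t.
rewrite rcons_path /= => /andP[/and3P[xb bc _] lx] /and3P[_ bt _] _.
have bN : b != last c t' by apply: contraNneq bt => ->; exact: mem_last.
case/negP: bN; apply/eqP; apply: ii.
have hb : index x s <= index b s by apply: mem_t; rewrite !inE eqxx orbT.
have hl : index x s <= index (last c t') s.
  by apply: mem_t; have := mem_last c t'; rewrite !inE => ->; rewrite !orbT.
move: xb lx hb hl; rewrite !adj => /orP[]/eqP h1 /orP[]/eqP h2 h3 h4.
- by rewrite h1 ltnn in h3.
- by rewrite h1 ltnn in h3.
- by rewrite h1 h2.
- by rewrite h2 ltnn in h4.
Qed.

(** * Double subdivision of an edge *)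

Lemma card_sum_pred (A B : finType) (P : pred (A + B)) :
  #|P| = #|[pred a | P (inl a)]| + #|[pred b | P (inr b)]|.
Proof. by rewrite -!sum1_card big_sumType. Qed.

(** Counts orbits through a complete invariant, so that orbits of a subdivision can be compared with
    those of the original map without following their canonical roots. *)
Lemma fcard_classes (T K : finType) (f : T -> T) (k : T -> K) :
  (forall x y, fconnect f x y = (k x == k y)) -> fcard f T = #|codom k|.
Proof.
move=> fk; have sy : connect_sym (frel f) by move=> x y; rewrite !fk eq_sym.
have inj : {in predI (froots f) T &, injective k}.
  move=> x y /andP[/eqP rx _] /andP[/eqP ry _] /eqP; rewrite -fk => /(rootP sy).
  by rewrite rx ry.
rewrite /n_comp_mem -(card_in_image inj); apply: eq_card => z.
apply/imageP/codomP => [[x _ ->]|[x ->]]; first by exists x.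
exists (froot f x); first by rewrite !inE andbT roots_root.
by apply/eqP; rewrite -fk connect_root.
Qed.

Lemma fconnect_froot (T : finType) (f : T -> T) : injective f ->
  forall x y, fconnect f x y = (froot f x == froot f y).
Proof. by move=> fi x y; rewrite root_connect //; apply: fconnect_sym. Qed.

(** A [node] step is directed, but it can be undone by continuing around the same vertex, which is
    not the avoided one. *)
Lemma avoid_connect_sym (m : cmap) (pm : plane_map m) (x : dart m) :
  connect_sym (adj_dart_avoid x).
Proof.
suff h : forall a b, connect (adj_dart_avoid x) a b -> connect (adj_dart_avoid x) b a.
  by move=> a b; apply/idP/idP; apply: h.
move=> a b /connectP[p + ->]; elim: p a => {b} [|c p IH] a /=; first by move=> _; exact: connect0.
case/andP=> /and3P[ac na nc] /IH h; apply: connect_trans h _.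
case/orP: ac => /eqP cE.
  by apply: connect1; rewrite /adj_dart_avoid /adj_dart nc na cE (edgeK pm) eqxx.
have: same_vertex c a by rewrite (same_vertex_sym pm) cE same_vertex1.
case/connectP=> q qp ->; elim: q c nc {cE} qp => //= b q IHq c nc /andP[/eqP cb qp].
have nb : ~~ same_vertex x b.
  apply: contra nc => xb; apply: same_vertex_trans xb _.
  by rewrite (same_vertex_sym pm) -cb same_vertex1.
apply: connect_trans (IHq _ nb qp); apply: connect1.
by rewrite /adj_dart_avoid /adj_dart nc nb -cb eqxx orbT.
Qed.

Section Subdivision.
Variables (m : cmap) (d0 : dart m).
Hypothesis pm : plane_map m.
Local Notation D := (dart m).
Local Notation N := (subdiv2 d0).
Local Notation e0 := (edge d0).

Definition old (d : D) : dart N := inl d.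
Definition new (k : nat) : dart N := inr (i4 k).

Lemma i4E (i : 'I_4) : i = i4 i. Proof. by rewrite /i4 inord_val. Qed.
Lemma i4_val k : k < 4 -> i4 k = k :> nat. Proof. exact: inordK. Qed.

Lemma subdiv_ind (P : dart N -> Prop) :
  P (old d0) -> P (old e0) -> (forall d, d != d0 -> d != e0 -> P (old d)) ->
  P (new 0) -> P (new 1) -> P (new 2) -> P (new 3) -> forall z, P z.
Proof.
move=> h1 h2 h3 h4 h5 h6 h7 [d|i].
  case: (eqVneq d d0) => [->//|n1]; case: (eqVneq d e0) => [->//|n2].
  exact: h3.
by rewrite [i]i4E; case: i => -[|[|[|[|]]]].
Qed.

Lemma edge_old d : d != d0 -> d != e0 -> @edge N (old d) = old (edge d).
Proof. by rewrite /= => /negbTE-> /negbTE->. Qed.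
Lemma edge_old_l : @edge N (old d0) = new 0.
Proof. by rewrite /= eqxx. Qed.
Lemma edge_old_r : @edge N (old e0) = new 3.
Proof. by rewrite /= (negbTE (edge_neq pm d0)) eqxx. Qed.
Lemma edge_new0 : @edge N (new 0) = old d0. Proof. by rewrite /= i4_val. Qed.
Lemma edge_new1 : @edge N (new 1) = new 2. Proof. by rewrite /= i4_val. Qed.
Lemma edge_new2 : @edge N (new 2) = new 1. Proof. by rewrite /= i4_val. Qed.
Lemma edge_new3 : @edge N (new 3) = old e0. Proof. by rewrite /= i4_val. Qed.
Lemma node_old d : @node N (old d) = old (node d). Proof. by []. Qed.
Lemma node_new0 : @node N (new 0) = new 1. Proof. by rewrite /= i4_val. Qed.
Lemma node_new1 : @node N (new 1) = new 0. Proof. by rewrite /= i4_val. Qed.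
Lemma node_new2 : @node N (new 2) = new 3. Proof. by rewrite /= i4_val. Qed.
Lemma node_new3 : @node N (new 3) = new 2. Proof. by rewrite /= i4_val. Qed.

Definition subdivE := (edge_old_l, edge_old_r, edge_new0, edge_new1, edge_new2,
  edge_new3, node_old, node_new0, node_new1, node_new2, node_new3).

(* The dart of the original map that a dart of the subdivision is part of. *)
Definition under (z : dart N) : D :=
  match z with
  | inl d => d
  | inr i => if odd i then d0 else e0
  end.

Lemma under_old d : under (old d) = d. Proof. by []. Qed.
Lemma under_new k : k < 4 -> under (new k) = if odd k then d0 else e0.
Proof. by move=> k4; rewrite /= i4_val. Qed.

(** A complete invariant of vertices: the new darts 0 and 1 leave one new vertex, 2 and 3 the
    other. *)
Definition vertex_class (z : dart N) : D + bool :=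
  match z with
  | inl d => inl (froot (@node m) d)
  | inr i => inr (2 <= i)
  end.

Lemma class_old d : vertex_class (old d) = inl (froot (@node m) d). Proof. by []. Qed.
Lemma class_new k : k < 4 -> vertex_class (new k) = inr (1 < k).
Proof. by move=> k4; rewrite /= i4_val. Qed.

Lemma subdiv_edgeK : involutive (@edge N).
Proof.
apply: subdiv_ind => [||d n1 n2||||]; rewrite ?subdivE // !edge_old ?(edgeK pm) //.
  by rewrite (inv_eq (edgeK pm)).
by rewrite (inj_eq (edge_inj pm)).
Qed.

Lemma subdiv_edge_neq z : @edge N z != z.
Proof.
move: z; apply: subdiv_ind => [||d n1 n2||||]; rewrite ?subdivE //.
- by rewrite edge_old //; apply: contraNneq (edge_neq pm d) => -[->].
- by apply/eqP => -[] /(congr1 val) /=; rewrite !i4_val.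
- by apply/eqP => -[] /(congr1 val) /=; rewrite !i4_val.
Qed.

Lemma subdiv_node_inj : injective (@node N).
Proof.
have inv i : @node N (@node N (inr i)) = inr i.
  by rewrite [i]i4E; case: i => -[|[|[|[|]]]] // ?;
     rewrite -/(new 0) -/(new 1) -/(new 2) -/(new 3) ?subdivE.
have isr i : exists j, @node N (inr i) = inr j.
  by rewrite /=; case: (nat_of_ord i) => [|[|[|k]]]; eexists.
move=> [x|i] [y|j] h.
- by case: h => /(node_inj pm) ->.
- by case: (isr j) => k; rewrite -h.
- by case: (isr i) => k; rewrite h.
- by rewrite -(inv i) h inv.
Qed.

Lemma subdiv_face_inj : injective (@face N).
Proof. by move=> x y /subdiv_node_inj/(inv_inj subdiv_edgeK). Qed.

Lemma under_edge z : under (@edge N z) = edge (under z).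
Proof.
move: z; apply: subdiv_ind => [||d n1 n2||||]; rewrite ?subdivE ?edge_old //;
by rewrite ?under_new //= ?under_new //= ?(edgeK pm).
Qed.

Lemma face_old d : d != d0 -> d != e0 -> @face N (old d) = old (face d).
Proof. by move=> n1 n2; rewrite {1}/face edge_old. Qed.
Lemma face_old_l : @face N (old d0) = new 1. Proof. by rewrite /face !subdivE. Qed.
Lemma face_old_r : @face N (old e0) = new 2. Proof. by rewrite /face !subdivE. Qed.
Lemma face_new0 : @face N (new 0) = old (face e0).
Proof. by rewrite /face !subdivE (edgeK pm). Qed.
Lemma face_new1 : @face N (new 1) = new 3. Proof. by rewrite /face !subdivE. Qed.
Lemma face_new2 : @face N (new 2) = new 0. Proof. by rewrite /face !subdivE. Qed.
Lemma face_new3 : @face N (new 3) = old (face d0). Proof. by rewrite /face !subdivE. Qed.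
Definition subdiv_faceE := (face_old_l, face_old_r, face_new0, face_new1, face_new2, face_new3).

Let sfr x y z : @same_face N x y -> @same_face N y z -> @same_face N x z.
Proof. exact: connect_trans. Qed.

Lemma old_under z : @same_face N z (old (under z)).
Proof.
have s1 x : @same_face N x (@face N x) by apply: fconnect1.
have sy x y : @same_face N x y = @same_face N y x.
  exact: fconnect_sym subdiv_face_inj _ _.
have s01 := s1 (old d0); have s02 := s1 (old e0).
have s13 := s1 (new 1); have s20 := s1 (new 2).
move: s01 s02 s13 s20; rewrite !subdiv_faceE => s01 s02 s13 s20.
move: z; apply: subdiv_ind => [||d n1 n2||||]; rewrite ?under_old ?under_new //=;
  try exact: connect0.
- by rewrite sy; apply: sfr s02 s20.
- by rewrite sy.
- by rewrite sy.
- by rewrite sy; apply: sfr s01 s13.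
Qed.

Lemma under_face z : same_face (under z) (under (@face N z)).
Proof.
move: z; apply: subdiv_ind => [||d n1 n2||||]; rewrite ?subdiv_faceE ?face_old //;
  rewrite ?under_new // ?under_old; first [exact: connect0 | exact: same_face1].
Qed.

(** Faces neither split nor merge: [under] keeps [face] steps within a face, and every dart shares
    its face with the old dart it is part of. *)
Lemma same_face_under a b : @same_face N a b = same_face (under a) (under b).
Proof.
have sy := fconnect_sym subdiv_face_inj.
apply/idP/idP.
  case/connectP=> p + ->; elim: p a => [|c p IH] a /=; first by move=> _; exact: connect0.
  case/andP=> /eqP <- /IH; apply: same_face_trans.
  exact: under_face.
have h x y : same_face x y -> @same_face N (old x) (old y).
  case/connectP=> p + ->; elim: p x => {y} [|y p IH] x /=; first by move=> _; exact: connect0.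
  case/andP=> /eqP <- /IH; apply: sfr.
  have f1 z : @same_face N (old (under z)) (old (under (@face N z))).
    apply: sfr (old_under (@face N z)); rewrite /same_face sy.
    apply: sfr (old_under z); rewrite /same_face sy; exact: fconnect1.
  rewrite -/(face x); case: (eqVneq x d0) => [->|n1]; first by have := f1 (new 3); rewrite face_new3 under_new.
  case: (eqVneq x e0) => [->|n2]; first by have := f1 (new 0); rewrite face_new0 under_new.
  by have := f1 (old x); rewrite face_old.
move/h; move=> h1; apply: sfr (old_under a) _; apply: sfr h1 _.
by rewrite /same_face sy; apply: old_under.
Qed.

Lemma on_outer_under z : @on_outer N z = on_outer (under z).
Proof. exact: same_face_under. Qed.

Lemma same_vertex_class a b : @same_vertex N a b = (vertex_class a == vertex_class b).
Proof.
have sy x y : @same_vertex N x y = same_vertex y x.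
  exact: fconnect_sym subdiv_node_inj _ _.
apply/idP/eqP.
  have frn x : froot (@node m) (node x) = froot (@node m) x.
    by apply/esym/(rootP (fconnect_sym (node_inj pm))); exact: fconnect1.
  apply: fconnect_const; apply: subdiv_ind => [||d n1 n2||||]; rewrite ?subdivE ?class_new //.
  - by congr inl; exact: frn.
  - by congr inl; exact: frn.
  - by congr inl; exact: frn.
have s1 x : @same_vertex N x (@node N x) by apply: fconnect1.
have ro x : @same_vertex N (old x) (old (froot (@node m) x)).
  case/connectP: (connect_root (frel (@node m)) x) => p pp ->.
  elim: p x pp => [|c p IH] x /=; first by move=> _; exact: connect0.
  by case/andP=> /eqP <- /IH; apply: connect_trans; apply: (s1 (old x)).
have rn i : @same_vertex N (inr i) (new (if 2 <= i then 2 else 0)).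
  rewrite [i]i4E; case: i => -[|[|[|[|]]]] //= ?; rewrite i4_val //=.
  - exact: connect0.
  - by have := s1 (new 1); rewrite node_new1.
  - exact: connect0.
  - by have := s1 (new 3); rewrite node_new3.
case: a b => [x|i] [y|j] //= [h].
  by apply: connect_trans (ro x) _; rewrite h -/(same_vertex _ _) sy ro.
by apply: connect_trans (rn i) _; rewrite h -/(same_vertex _ _) sy rn.
Qed.

Lemma same_vertex_old x y : @same_vertex N (old x) (old y) = same_vertex x y.
Proof.
rewrite same_vertex_class /same_vertex fconnect_froot; last exact: node_inj.
by rewrite !class_old; apply/eqP/eqP => [[]|->].
Qed.
Lemma same_vertex_old_new x k : @same_vertex N (old x) (new k) = false.
Proof. by rewrite same_vertex_class. Qed.
Lemma same_vertex_new_old x k : @same_vertex N (new k) (old x) = false.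
Proof. by rewrite same_vertex_class. Qed.
Lemma same_vertex_new i j : i < 4 -> j < 4 ->
  @same_vertex N (new i) (new j) = ((1 < i) == (1 < j)).
Proof.
by move=> hi hj; rewrite same_vertex_class !class_new //; apply/eqP/eqP => [[]|->].
Qed.
Definition subdiv_vertexE := (same_vertex_old, same_vertex_old_new, same_vertex_new_old).

Lemma subdiv_connected : map_connected m -> map_connected N.
Proof.
move=> cm; pose c := connect (@adj_dart N).
have step a b : adj_dart a b -> c a b by apply: connect1.
have se a : c a (@edge N a) by apply: step; rewrite /adj_dart eqxx.
have sn a : c a (@node N a) by apply: step; rewrite /adj_dart eqxx orbT.
have tr a b d : c a b -> c b d -> c a d by exact: (@connect_trans _ (@adj_dart N)).
have h1 := se (old d0); have h2 := sn (new 0); have h3 := se (new 1).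
have h4 := sn (new 2); have h5 := se (new 3); have g1 := se (new 0).
have g2 := sn (new 1); have g3 := se (new 2); have g4 := sn (new 3); have g5 := se (old e0).
move: h1 h2 h3 h4 h5 g1 g2 g3 g4 g5; rewrite !subdivE => h1 h2 h3 h4 h5 g1 g2 g3 g4 g5.
have oo x y : c (old x) (old y).
  case/connectP: (cm x y) => p + ->; elim: p x => {y} [|y p IH] x /=; first by move=> _; exact: connect0.
  case/andP=> /orP[]/eqP-> /IH; apply: (tr); last exact: sn.
  case: (eqVneq x d0) => [->|n1]; first by exact: tr h1 (tr _ _ _ h2 (tr _ _ _ h3 (tr _ _ _ h4 h5))).
  case: (eqVneq x e0) => [->|n2].
    by rewrite (edgeK pm); apply: tr g5 (tr _ _ _ g4 (tr _ _ _ g3 (tr _ _ _ g2 g1))).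
  by have := se (old x); rewrite edge_old.
have to z : c (old d0) z.
  move: z; apply: subdiv_ind => [||d n1 n2||||]; rewrite ?oo //.
  - exact: tr h1 h2.
  - exact: tr h1 (tr _ _ _ h2 h3).
  - exact: tr h1 (tr _ _ _ h2 (tr _ _ _ h3 h4)).
have fro z : c z (old d0).
  move: z; apply: subdiv_ind => [||d n1 n2||||]; rewrite ?oo //.
  - exact: tr g2 g1.
  - exact: tr g3 (tr _ _ _ g2 g1).
  - exact: tr g4 (tr _ _ _ g3 (tr _ _ _ g2 g1)).
by move=> x y; apply: tr (fro x) (to y).
Qed.

Lemma fcard_node_subdiv : fcard (@node N) (dart N) = (fcard (@node m) D).+2.
Proof.
rewrite (fcard_classes same_vertex_class).
rewrite (fcard_classes (fconnect_froot (node_inj pm))) card_sum_pred -addn2; congr (_ + _).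
  apply: eq_card => x; apply/codomP/codomP => [[[y|i] //= [->]]|[y ->]]; first by exists y.
  by exists (old y).
rewrite -card_bool; apply: eq_card => b; rewrite [RHS]inE; apply/codomP.
by exists (new (if b then 2 else 0)); rewrite class_new; case: b.
Qed.

Lemma fcard_face_subdiv : fcard (@face N) (dart N) = fcard (@face m) D.
Proof.
rewrite (@fcard_classes _ _ _ (fun z => froot (@face m) (under z))) => [|x y].
  rewrite (fcard_classes (fconnect_froot (face_inj pm))).
  by apply: eq_card => x; apply/codomP/codomP => [[y ->]|[y ->]];
    [exists (under y) | exists (old y)].
by rewrite -fconnect_froot; [exact: same_face_under | exact: face_inj].
Qed.

(** Euler's formula persists because there are two more vertices, four more darts and equally many
    faces. *)
Lemma subdiv_plane : plane_map N.
Proof.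
split; [exact: subdiv_edgeK|exact: subdiv_edge_neq|exact: subdiv_node_inj| |].
  by apply: subdiv_connected; case: pm.
rewrite fcard_node_subdiv fcard_face_subdiv card_sum card_ord.
by case: pm => _ _ _ _; lia.
Qed.

End Subdivision.

(** * A double subdivision of a boundary edge is again a catacondensed system *)

Section SubdivisionErs.
Variables (m : cmap) (d0 : dart m).
Hypothesis ers : even_ring_system m.
Let pm := ers_plane ers.
Local Notation D := (dart m).
Local Notation N := (subdiv2 d0).
Local Notation e0 := (edge d0).
Local Notation old := (@old m d0).
Local Notation new := (@new m d0).

Lemma subdiv_simple : simple_map N.
Proof.
have sv := same_vertex_edge ers.
split.
  apply: (subdiv_ind (d0 := d0)) => [||d n1 n2||||]; rewrite ?(subdivE d0 pm) ?edge_old //;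
  by rewrite ?(subdiv_vertexE d0 pm) ?(same_vertex_new d0 pm).
apply: (subdiv_ind (d0 := d0)) => [||d n1 n2||||];
  apply: (subdiv_ind (d0 := d0)) => [||d' n1' n2'||||];
  rewrite ?(subdivE d0 pm) ?edge_old ?(subdiv_vertexE d0 pm) ?(same_vertex_new d0 pm) ?edge_old //.
by move=> h1 h2; rewrite (simple_eq ers h1 h2).
Qed.

Lemma subdiv_bipartite : bipartite_map N.
Proof.
case: ers => -[_ _ [c [cv ce]] _] _.
exists (fun z : dart N => match z with inl d => c d | inr i => if 2 <= i then c d0 else ~~ c d0 end).
split=> [x y|].
  move: x y; apply: (subdiv_ind (d0 := d0)) => [||d n1 n2||||];
  apply: (subdiv_ind (d0 := d0)) => [||d' n1' n2'||||];
  rewrite ?(subdiv_vertexE d0 pm) ?(same_vertex_new d0 pm) ?i4_val //= ?i4_val //=; exact: cv.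
have c1 := ce d0.
apply: (subdiv_ind (d0 := d0)) => [||d n1 n2||||]; rewrite ?(subdivE d0 pm) ?edge_old //=
  ?i4_val //=; by move: c1; do 2!case: (c _).
Qed.

Section Avoid.
Variable x : dart N.
Local Notation av z := (~~ same_vertex x z).
Local Notation C := (connect (adj_dart_avoid x)).

Let sy : connect_sym (adj_dart_avoid x).
Proof. exact: avoid_connect_sym (subdiv_plane d0 pm) x. Qed.
Let tr a b c : C a b -> C b c -> C a c.
Proof. exact: connect_trans. Qed.
Let se a : av a -> av (edge a) -> C a (edge a).
Proof. by move=> h1 h2; apply: connect1; rewrite /adj_dart_avoid /adj_dart h1 h2 eqxx. Qed.
Let sn a : av a -> av (node a) -> C a (node a).
Proof. by move=> h1 h2; apply: connect1; rewrite /adj_dart_avoid /adj_dart h1 h2 eqxx orbT. Qed.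

Let link_old : av (old d0) -> av (new 0) -> C (old d0) (new 0).
Proof. by move=> a b; have := se a; rewrite edge_old_l; apply. Qed.
Let link01 : av (new 0) -> av (new 1) -> C (new 0) (new 1).
Proof. by move=> a b; have := sn a; rewrite node_new0; apply. Qed.
Let link12 : av (new 1) -> av (new 2) -> C (new 1) (new 2).
Proof. by move=> a b; have := se a; rewrite edge_new1; apply. Qed.
Let link23 : av (new 2) -> av (new 3) -> C (new 2) (new 3).
Proof. by move=> a b; have := sn a; rewrite node_new2; apply. Qed.
Let link3 : av (new 3) -> av (old e0) -> C (new 3) (old e0).
Proof. by move=> a b; have := se a; rewrite edge_new3; apply. Qed.

Let hub h : (forall z, av z -> C h z) -> forall a b, av a -> av b -> C a b.
Proof. by move=> H a b ha hb; apply: tr (H _ hb); rewrite sy H. Qed.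

(** A path of the original map lifts, the subdivided edge being replaced by the detour through the
    new vertices. The new darts hang from an end of that edge that is not deleted; one exists
    because an edge is not a loop. *)
Lemma avoid_old x0 : x = old x0 -> forall a b, av a -> av b -> C a b.
Proof.
move=> xE; have avn k : av (new k) by rewrite xE (subdiv_vertexE d0 pm).
have avo y : av (old y) = ~~ same_vertex x0 y by rewrite xE (subdiv_vertexE d0 pm).
have c03 : C (new 0) (new 3).
  by apply: tr (link01 _ _) (tr (link12 _ _) (link23 _ _)).
have ch : av (old d0) -> av (old e0) -> C (old d0) (old e0).
  by move=> h1 h2; apply: tr (link_old _ _) (tr c03 (link3 _ _)).
have oo y z : av (old y) -> av (old z) -> C (old y) (old z).
  rewrite !avo => hy hz.
  case: ers => -[_ _ _ [_ _ tc]] _; case/connectP: (tc _ _ _ hy hz) => p + ->.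
  elim: p y {hy} => [|c p IH] y /=; first by move=> _; exact: connect0.
  case/andP=> /and3P[yc hy hc] /IH; apply: (tr _).
  case/orP: yc => /eqP cE; last first.
    by rewrite cE; apply: (sn (a := old y)); rewrite ?avo // -cE.
  case: (eqVneq y d0) => [yE|n1]; first by rewrite cE yE ch // avo -yE // -cE.
  case: (eqVneq y e0) => [yE|n2].
    by rewrite cE yE sy (edgeK pm) ch // avo -?yE // -[d0](edgeK pm) -yE -cE.
  by rewrite cE -edge_old //; apply: se; rewrite ?edge_old // avo // -cE.
have sv : ~~ (same_vertex x0 d0 && same_vertex x0 e0).
  apply: contra (same_vertex_edge ers d0) => /andP[h1 h2].
  by apply: same_vertex_trans h2; rewrite (same_vertex_sym pm).
case: (boolP (same_vertex x0 d0)) sv => [_ /= h|h _]; rewrite -avo in h.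
  apply: (hub (h := old e0)); have g3 : C (old e0) (new 3) by rewrite sy; apply: link3.
  have g2 : C (old e0) (new 2) by apply: tr g3 _; rewrite sy; apply: link23.
  have g1 : C (old e0) (new 1) by apply: tr g2 _; rewrite sy; apply: link12.
  have g0 : C (old e0) (new 0) by apply: tr g1 _; rewrite sy; apply: link01.
  by apply: (subdiv_ind (d0 := d0)) => [||d n1 n2||||] // hd; apply: oo.
apply: (hub (h := old d0)); have g0 : C (old d0) (new 0) by apply: link_old.
have g1 : C (old d0) (new 1) by apply: tr g0 _; apply: link01.
have g2 : C (old d0) (new 2) by apply: tr g1 _; apply: link12.
have g3 : C (old d0) (new 3) by apply: tr g2 _; apply: link23.
by apply: (subdiv_ind (d0 := d0)) => [||d n1 n2||||] // hd; apply: oo.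
Qed.

(* Deleting the subdivided edge leaves the map connected: avoid one of its
   endpoints, which has a second neighbour. *)
Lemma avoid_new_old k d1 y : x = new k -> d1 = d0 \/ d1 = e0 ->
  C (old y) (old (edge d1)).
Proof.
move=> xE dE; have avo z : av (old z) by rewrite xE (subdiv_vertexE d0 pm).
have d01 a : a != d1 -> a != edge d1 -> a != d0 /\ a != e0.
  by case: dE => ->; rewrite ?(edgeK pm).
have far z : ~~ same_vertex d1 z -> C (old z) (old (edge d1)).
  move=> hz; case: ers => -[_ _ _ [_ _ tc]] _.
  case/connectP: (tc _ _ _ hz (same_vertex_edge ers d1)) => p + ->.
  elim: p z {hz} => [|c p IH] z /=; first by move=> _; exact: connect0.
  case/andP=> /and3P[zc hz hc] /IH; apply: (tr _).
  case/orP: zc => /eqP cE; last by rewrite cE; apply: (sn (avo z) (avo _)).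
  have [||n1 n2] := d01 z.
  - by apply: contraNneq hz => ->; exact: same_vertex_refl.
  - by apply: contraNneq hc => zE; rewrite cE zE (edgeK pm) same_vertex_refl.
  - by rewrite cE -edge_old //; apply: se; rewrite ?edge_old.
case: (boolP (same_vertex d1 y)) => [yv|/far//].
have yt : same_vertex y (node d1).
  by apply: same_vertex_trans (same_vertex1 d1); rewrite (same_vertex_sym pm).
apply: (tr (b := old (node d1))).
  case/connectP: yt => p + ->; elim: p y {yv} => [|c p IH] z /=.
    by move=> _; exact: connect0.
  by case/andP=> /eqP <- /IH; apply: (tr _); apply: (sn (avo z) (avo _)).
have [||n1 n2] := d01 (node d1).
- exact: node_neq.
- by apply: contraNneq (same_vertex_edge ers d1) => <-; exact: same_vertex1.
apply: (tr (b := old (edge (node d1)))).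
  by rewrite -edge_old //; apply: se; rewrite ?edge_old.
apply: far; apply: contra (same_vertex_edge ers (node d1)) => h.
by apply: same_vertex_trans h; rewrite (same_vertex_sym pm) same_vertex1.
Qed.

Lemma avoid_new k : k < 4 -> x = new k -> forall a b, av a -> av b -> C a b.
Proof.
move=> k4 xE; have avn j : j < 4 -> av (new j) = ((1 < k) != (1 < j)).
  by move=> j4; rewrite xE (same_vertex_new d0 pm).
have avo z : av (old z) by rewrite xE (subdiv_vertexE d0 pm).
case: (boolP (1 < k)) avn => k1 avn.
  have oo y : C (old d0) (old y).
    by rewrite sy; have := avoid_new_old y xE (or_intror erefl); rewrite (edgeK pm).
  apply: (hub (h := old d0)).
  apply: (subdiv_ind (d0 := d0)) => [||d n1 n2||||]; rewrite ?avn // => _; try exact: oo.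
    by apply: link_old => //; rewrite avn.
  by apply: tr (link_old _ _) (link01 _ _); rewrite ?avn.
have oo y : C (old e0) (old y).
  by rewrite sy; exact: avoid_new_old y xE (or_introl erefl).
apply: (hub (h := old e0)).
apply: (subdiv_ind (d0 := d0)) => [||d n1 n2||||]; rewrite ?avn // => _; try exact: oo;
  rewrite sy.
  by apply: tr (link23 _ _) (link3 _ _); rewrite ?avn.
by apply: link3 => //; rewrite avn.
Qed.
End Avoid.

Lemma subdiv_two_connected : two_connected N.
Proof.
case: (ers) => -[_ _ _ [h3 hc _]] _; split.
- by rewrite (fcard_node_subdiv d0 pm); apply: leq_trans h3 _; rewrite -addn2 leq_addr.
- exact: subdiv_connected.
- apply: (subdiv_ind (d0 := d0)) => [||d n1 n2||||] a b;
  by [exact: (avoid_old erefl) | exact: (avoid_new _ erefl)].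
Qed.

Lemma subdiv_deg_old d : deg (old d) = deg d.
Proof.
rewrite /deg /fingraph.order card_sum_pred -[RHS]addn0; congr (_ + _).
  by apply: eq_card => y; rewrite !inE -[LHS]/(same_vertex (old d) (old y)) (same_vertex_old d0 pm).
apply: eq_card0 => i; rewrite !inE [i]i4E.
by rewrite -[LHS]/(same_vertex (old d) (new i)) (subdiv_vertexE d0 pm).
Qed.

Lemma subdiv_deg_new k : k < 4 -> deg (new k) = 2.
Proof.
move=> k4; rewrite /deg /fingraph.order card_sum_pred (eq_card0 (A := [pred a | _])).
  rewrite add0n; have c2 : #|[set i4 (if 1 < k then 2 else 0); i4 (if 1 < k then 3 else 1)]| = 2.
    rewrite cards2; case: eqP => // /(congr1 val) /=; rewrite !i4_val; by case: ifP.
  rewrite -[RHS]c2; apply: eq_card => i; rewrite !inE [i]i4E; have i4' := ltn_ord i.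
  rewrite -[LHS]/(same_vertex (new k) (new i)) (same_vertex_new d0 pm) //.
  rewrite -!val_eqE /= !i4_val //; try by case: ifP.
  by case: (1 < k); move: (nat_of_ord i) i4'; do 5?case.
by move=> y; rewrite !inE -[LHS]/(same_vertex (new k) (old y)) (subdiv_vertexE d0 pm).
Qed.

Lemma subdiv_even_ring : boundary_segment_dart d0 -> even_ring_system N.
Proof.
move=> bd.
have bn k : k < 4 -> boundary_vertex (new k).
  move=> k4; have b01 : on_outer d0 || on_outer e0.
    by case/orP: bd => /andP[-> _]; rewrite ?orbT.
  (* Odd new darts lie on the face of [d0], even ones on that of [edge d0]; adding [on_outer d0]
     picks, at the given new vertex, the dart on the outer face. *)
  apply/existsP; exists (new ((if 1 < k then 2 else 0) + on_outer d0)).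
  rewrite (same_vertex_new d0 pm) // ?(on_outer_under pm) ?under_new //;
    by case: (1 < k); case: (boolP (on_outer d0)) b01.
have bo d : boundary_vertex (old d) = boundary_vertex d.
  apply/existsP/existsP => -[]; last first.
    by move=> y yv; exists (old y); rewrite (subdiv_vertexE d0 pm) (on_outer_under pm).
  by apply: (subdiv_ind (d0 := d0)) => [||y n1 n2||||]; rewrite ?(subdiv_vertexE d0 pm) ?andFb // => h;
    [exists d0 | exists e0 | exists y]; rewrite (on_outer_under pm) in h.
case: (ers) => _ [h3 h2]; split.
  by split; [exact: subdiv_plane | exact: subdiv_simple | exact: subdiv_bipartite |
             exact: subdiv_two_connected].
split; apply: (subdiv_ind (d0 := d0)) => [||d n1 n2||||];
  by rewrite ?bo ?bn ?subdiv_deg_old ?subdiv_deg_new // => ?; apply: h3 || apply: h2.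
Qed.

(** [under] induces an isomorphism of inner duals, whose inverse comes from [old]. *)
Lemma subdiv_dual_tree : dual_is_tree m -> dual_is_tree N.
Proof.
move=> [dc da]; have pN := subdiv_plane d0 pm.
have hp (a : inner_face N) : ~~ on_outer (under (val a)).
  by rewrite -(on_outer_under pm) inner_face_outer.
have hq (a : inner_face m) : ~~ on_outer (old (val a)).
  by rewrite (on_outer_under pm) inner_face_outer.
pose h a := face_of pm (hp a); pose k a := face_of pN (hq a).
have kh a : k (h a) = a.
  apply/eqP; rewrite inner_face_eq // -(same_face_l pN (same_face_of pN (hq _))).
  rewrite (same_face_under pm) // under_old /h.
  by rewrite (same_face_sym pm) same_face_of.
have hadj a b : dual_adj (h a) (h b) = dual_adj a b.
  have sh x (c : inner_face N) : same_face (val (h c)) x = same_face (under (val c)) x.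
    by rewrite -(same_face_l pm (same_face_of pm (hp c))).
  have hE : (h a == h b) = (a == b).
    by rewrite face_of_eq inner_face_eq // (same_face_under pm).
  apply/idP/idP => /(@dual_adjP _ _ _)[x [ax bx ab]].
    rewrite sh in ax; rewrite sh in bx; apply: (dual_adjI (x := old x)).
    - by rewrite -hE.
    - by rewrite (same_face_under pm).
    - by rewrite (same_face_under pm) // (under_edge pm) // under_old.
  apply: (dual_adjI (x := under x)); rewrite ?hE // sh.
    by rewrite -(same_face_under pm).
  by rewrite -(under_edge pm) // -(same_face_under pm).
have hk a : h (k a) = a.
  apply/eqP; rewrite inner_face_eq // -(same_face_l pm (same_face_of pm (hp _))).
  rewrite (same_face_sym pm) -[val a]/(under (old (val a))) -(same_face_under pm) //.
  exact: same_face_of.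
have hi : injective h by apply: can_inj kh.
split.
  move=> a b; rewrite -(kh a) -(kh b); case/connectP: (dc (h a) (h b)) => p + ->.
  elim: p (h a) => [|c p IH] y /=; first by move=> _; exact: connect0.
  case/andP=> yc /IH; apply: connect_trans; apply: connect1.
  by rewrite -hadj !hk.
case=> s [us s3 cs]; apply: da; exists (map h s); split.
- by rewrite map_inj_uniq.
- by rewrite size_map.
- by rewrite cycle_map (eq_cycle (e' := @dual_adj N)).
Qed.
End SubdivisionErs.

(** * Resonance graphs under transformations and isomorphisms *)

Lemma graph_iso_refl (T : finType) (r : rel T) : graph_iso r r.
Proof. by exists id; split=> //; exists id. Qed.

Lemma graph_iso_sym (T1 T2 : finType) (r1 : rel T1) (r2 : rel T2) :
  graph_iso r1 r2 -> graph_iso r2 r1.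
Proof.
move=> [f [[g fK gK] h]]; exists g; split; first by exists f.
by move=> x y; rewrite -h !gK.
Qed.

Lemma graph_iso_trans (T1 T2 T3 : finType) (r1 : rel T1) (r2 : rel T2) (r3 : rel T3) :
  graph_iso r1 r2 -> graph_iso r2 r3 -> graph_iso r1 r3.
Proof.
move=> [f [fb h]] [g [gb k]]; exists (g \o f); split; first exact: bij_comp.
by move=> x y /=; rewrite k h.
Qed.

Lemma perfect_matchingP (m : cmap) (M : {set dart m}) :
  reflect ((forall d, (edge d \in M) = (d \in M)) /\
           (forall d, #|[set e in M | same_vertex d e]| = 1))
          (perfect_matching M).
Proof.
apply: (iffP andP) => [[/forallP h1 /forallP h2]|[h1 h2]].
  by split=> d; apply/eqP; [apply: h1 | apply: h2].
by split; apply/forallP => d; [rewrite h1 | rewrite h2].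
Qed.

Lemma in_symdiff (m : cmap) (A B : {set dart m}) x :
  (x \in symdiff A B) = (x \in A) (+) (x \in B).
Proof. by rewrite !inE; do 2!case: (x \in _). Qed.

Lemma res_adjP (m : cmap) (M1 M2 : res_vertex m) :
  reflect (exists2 f, ~~ on_outer f & symdiff (val M1) (val M2) = face_edges f)
          (res_adj M1 M2).
Proof.
apply: (iffP existsP) => [[f /andP[h /eqP k]]|[f h k]]; first by exists f.
by exists f; rewrite h k eqxx.
Qed.

(** * Perfect matchings of a double subdivision *)

Section SubdivisionResonance.
Variables (m : cmap) (d0 : dart m).
Hypothesis pm : plane_map m.
Local Notation D := (dart m).
Local Notation N := (subdiv2 d0).
Local Notation e0 := (edge d0).
Local Notation old := (@old m d0).
Local Notation new := (@new m d0).

(** Of the three edges replacing a matched edge, the two extreme ones are matched; if the edge was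
    unmatched, only the middle one is, which consists of the new darts 1 and 2. *)
Let extend (M : {set D}) : {set dart N} :=
  [set z : dart N | match z with inl d => d \in M | inr i => (d0 \in M) (+) (0 < i < 3) end].
Let restrict (M : {set dart N}) : {set D} := [set d | old d \in M].

Let ext_old M d : (old d \in extend M) = (d \in M).
Proof. by rewrite inE. Qed.
Let ext_new M k : k < 4 -> (new k \in extend M) = (d0 \in M) (+) (0 < k < 3).
Proof. by move=> k4; rewrite inE /= i4_val. Qed.

Let card_old (A : {set dart N}) x :
  #|[set e in A | same_vertex (old x) e]| = #|[set e in restrict A | same_vertex x e]|.
Proof.
rewrite card_sum_pred -[RHS]addn0; congr (_ + _).
  apply: eq_card => y; rewrite inE -[LHS]/(old y \in [set e in A | same_vertex (old x) e]).
  by rewrite !inE (same_vertex_old d0 pm).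
apply: eq_card0 => i; rewrite inE [i]i4E.
rewrite -[LHS]/(new i \in [set e in A | same_vertex (old x) e]).
by rewrite inE (subdiv_vertexE d0 pm) andbF.
Qed.

Let card_new (A : {set dart N}) k : k < 4 ->
  #|[set e in A | same_vertex (new k) e]| =
  (new (if 1 < k then 2 else 0) \in A) + (new (if 1 < k then 3 else 1) \in A).
Proof.
move=> k4; set a := new (if 1 < k then 2 else 0); set b := new (if 1 < k then 3 else 1).
have ab : a \notin [set b].
  rewrite inE /a /b; apply/eqP => -[] /(congr1 val) /=; rewrite !i4_val; by case: (1 < k).
have -> : [set e in A | same_vertex (new k) e] = [set e in a |: [set b] | e \in A].
  apply/setP => z; rewrite !inE andbC; congr (_ && _).
  case: z => [d|i]; first by rewrite -[inl d]/(old d) (subdiv_vertexE d0 pm).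
  have i4' := ltn_ord i.
  rewrite -[LHS]/(same_vertex (new k) (inr i)) {1}[i]i4E -[inr (i4 i)]/(new i).
  rewrite (same_vertex_new d0 pm) // /a /b.
  have inrE (j : 'I_4) : (inr i == inr j :> dart N) = (i == j).
    by apply/eqP/eqP => [[]|->].
  rewrite !inrE -!val_eqE /= !i4_val //; try by case: (1 < k).
  by case: (1 < k); move: (nat_of_ord i) i4' => [|[|[|[|j]]]] //.
rewrite -sum1dep_card big_mkcondr /= big_setU1 //= big_set1.
by case: (a \in A); case: (b \in A).
Qed.

Let extend_pm M : perfect_matching M -> perfect_matching (extend M).
Proof.
move=> /perfect_matchingP[Me Mv]; apply/perfect_matchingP; split.
  apply: (subdiv_ind (d0 := d0)) => [||d n1 n2||||]; rewrite ?(subdivE d0 pm) ?edge_old //;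
  by rewrite ?ext_old ?ext_new //= ?Me ?addbF.
have rK : restrict (extend M) = M by apply/setP => d; rewrite inE ext_old.
apply: (subdiv_ind (d0 := d0)) => [||d n1 n2||||];
  rewrite ?card_old ?rK ?card_new //= !ext_new //=; by case: (d0 \in M).
Qed.

Let restrict_pm M : perfect_matching M ->
  perfect_matching (restrict M) /\ extend (restrict M) = M.
Proof.
move=> /perfect_matchingP[Me Mv].
have e1 : (new 0 \in M) = (old d0 \in M) by rewrite -(edge_old_l d0) Me.
have e2 : (new 1 \in M) = (new 2 \in M) by rewrite -(edge_new1 d0) Me.
have e3 : (new 3 \in M) = (old e0 \in M) by rewrite -(edge_new3 d0) Me.
have v1 := Mv (new 0); have v2 := Mv (new 2).
rewrite card_new //= in v1; rewrite card_new //= in v2.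
have n1 : (new 1 \in M) = ~~ (old d0 \in M).
  by move: v1; rewrite e1; do 2!case: (_ \in M).
have n3 : (old e0 \in M) = (old d0 \in M).
  by move: v2; rewrite e3 -e2 n1; do 2!case: (_ \in M).
split; last first.
  apply/setP; apply: (subdiv_ind (d0 := d0)) => [||d k1 k2||||];
  rewrite ?ext_old ?ext_new //= inE //.
  - by rewrite e1 addbF.
  - by rewrite addbT n1.
  - by rewrite addbT -e2 n1.
  - by rewrite addbF e3 n3.
apply/perfect_matchingP; split=> d; last by rewrite -card_old.
rewrite !inE; case: (eqVneq d d0) => [->//|k1].
case: (eqVneq d e0) => [->|k2]; first by rewrite (edgeK pm).
by rewrite -edge_old // Me.
Qed.

Lemma subdiv_resonance : resonance_iso m N.
Proof.
have face_lift f : face_edges f = [set z : dart N | under z \in face_edges (under f)].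
  by apply/setP => z; rewrite !inE !(same_face_under pm) (under_edge pm).
(* The complementation on the middle edge happens in both matchings and cancels in their difference,
   so differences, like face boundaries, pull back along [under]. *)
have sym_lift (M1 M2 : res_vertex m) : symdiff (extend (val M1)) (extend (val M2)) =
    [set z : dart N | under z \in symdiff (val M1) (val M2)].
  case: M1 M2 => [M1 /= /perfect_matchingP[e1 _]] [M2 /= /perfect_matchingP[e2 _]].
  apply/setP => z; rewrite (@in_symdiff N) [RHS]inE in_symdiff.
  move: z; apply: (subdiv_ind (d0 := d0)) => [||d n1 n2||||];
  rewrite ?ext_old ?ext_new ?under_old ?under_new //;
  by rewrite /= ?e1 ?e2; do 2!case: (d0 \in _).
have liftP (A B : {set D}) : ([set z : dart N | under z \in A] = [set z | under z \in B]) <-> A = B.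
  split=> [/setP h|-> //]; apply/setP => x.
  by have := h (old x); rewrite !inE.
exists (fun M => Sub (extend (val M)) (extend_pm (valP M))); split.
  exists (fun M => Sub (restrict (val M)) (proj1 (restrict_pm (valP M)))) => M.
    by apply: val_inj; apply/setP => d; rewrite inE ext_old.
  by apply: val_inj; rewrite /= (proj2 (restrict_pm (valP M))).
move=> M1 M2; apply/res_adjP/res_adjP => -[f of_]; rewrite /= ?sym_lift.
  rewrite face_lift => /liftP h; exists (under f) => //.
  by rewrite -(on_outer_under pm).
move=> h; exists (old f); first by rewrite (on_outer_under pm).
by rewrite face_lift under_old -h.
Qed.
End SubdivisionResonance.

Lemma perfect_matching_imset (m1 m2 : cmap) (f : dart m1 -> dart m2)
  (g : dart m2 -> dart m1) : cancel f g -> cancel g f ->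
  (forall d, f (edge d) = edge (f d)) ->
  (forall d e, same_vertex (f d) (f e) = same_vertex d e) ->
  forall M, perfect_matching M -> perfect_matching (f @: M).
Proof.
move=> fK gK fe fv M; have fi := can_inj fK.
move=> /perfect_matchingP[Me Mv]; apply/perfect_matchingP; split=> d.
  by rewrite -(gK d) -fe !mem_imset.
rewrite -(Mv (g d)) -(card_imset _ fi); apply: eq_card => z.
by rewrite -(gK z) -{1}(gK d) inE !mem_imset // inE fv.
Qed.

(** Phrased through the edge sets of inner faces, so that it serves both map isomorphisms, which
    respect [face], and abstract graph isomorphisms, for which only these edge sets can be
    recovered. *)
Lemma resonance_iso_of_faces (m1 m2 : cmap) (f : dart m1 -> dart m2)
  (g : dart m2 -> dart m1) : cancel f g -> cancel g f ->
  (forall d, f (edge d) = edge (f d)) ->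
  (forall d e, same_vertex (f d) (f e) = same_vertex d e) ->
  (forall x, ~~ on_outer x ->
     exists2 y, ~~ on_outer y & f @: face_edges x = face_edges y) ->
  (forall x, ~~ on_outer x ->
     exists2 y, ~~ on_outer y & g @: face_edges x = face_edges y) ->
  resonance_iso m1 m2.
Proof.
move=> fK gK fe fv h1 h2; have fi := can_inj fK.
have ge d : g (edge d) = edge (g d) by rewrite -{1}(gK d) -fe fK.
have gv d e : same_vertex (g d) (g e) = same_vertex d e by rewrite -fv !gK.
have fgs (A : {set dart m2}) : f @: (g @: A) = A.
  by rewrite -imset_comp (eq_imset (g := id)) ?imset_id // => x; rewrite /= gK.
have gfs (A : {set dart m1}) : g @: (f @: A) = A.
  by rewrite -imset_comp (eq_imset (g := id)) ?imset_id // => x; rewrite /= fK.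
pose F (M : res_vertex m1) : res_vertex m2 :=
  Sub (f @: val M) (perfect_matching_imset fK gK fe fv (valP M)).
pose G (M : res_vertex m2) : res_vertex m1 :=
  Sub (g @: val M) (perfect_matching_imset gK fK ge gv (valP M)).
exists F; split.
  by exists G => M; apply: val_inj; rewrite /= ?fgs ?gfs.
have sE (A B : {set dart m1}) : symdiff (f @: A) (f @: B) = f @: symdiff A B.
  by apply/setP => z; rewrite -(gK z) in_symdiff !mem_imset // in_symdiff.
move=> M1 M2; apply/res_adjP/res_adjP => -[x ox]; rewrite /= ?sE => h.
  by case: (h2 x ox) => y oy yE; exists y; rewrite // -yE -h gfs.
by case: (h1 x ox) => y oy yE; exists y; rewrite // h yE.
Qed.

Lemma map_iso_resonance m1 m2 : plane_map m2 -> map_iso m1 m2 -> resonance_iso m1 m2.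
Proof.
move=> pm2; case=> f [[g fK gK] fe fn fo].
have ge d : g (edge d) = edge (g d) by rewrite -{1}(gK d) -fe fK.
have gn d : g (node d) = node (g d) by rewrite -{1}(gK d) -fn fK.
have con (T1 T2 : finType) (p1 : T1 -> T1) (p2 : T2 -> T2) (h : T1 -> T2) :
    (forall x, h (p1 x) = p2 (h x)) ->
    forall x y, fconnect p1 x y -> fconnect p2 (h x) (h y).
  move=> hp x y /connectP[p + ->]; elim: p x => [|z p IH] x /=.
    by move=> _; exact: connect0.
  case/andP=> /eqP <- /IH; apply: connect_trans.
  by rewrite hp; exact: fconnect1.
have ff d : f (face d) = face (f d) by rewrite /face fn fe.
have gf d : g (face d) = face (g d) by rewrite /face gn ge.
have fv d e : same_vertex (f d) (f e) = same_vertex d e.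
  apply/idP/idP => [h|]; last exact: con fn _ _.
  by rewrite -(fK d) -(fK e); exact: con gn _ _ h.
have fs d e : same_face (f d) (f e) = same_face d e.
  apply/idP/idP => [h|]; last exact: con ff _ _.
  by rewrite -(fK d) -(fK e); exact: con gf _ _ h.
have fo' d : on_outer (f d) = on_outer d.
  by rewrite /on_outer -fs; apply: (same_face_l pm2).
apply: (resonance_iso_of_faces fK gK fe fv) => x ox.
  exists (f x); first by rewrite fo'.
  by apply/setP => z; rewrite -(gK z) mem_imset ?inE -?fe ?fs //; exact: can_inj fK.
exists (g x); first by rewrite -fo' gK.
have gs a b : same_face (g a) (g b) = same_face a b by rewrite -fs !gK.
apply/setP => z; rewrite -(fK z) mem_imset; last exact: can_inj gK.
by rewrite !inE -ge !gs.
Qed.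

(** * Face boundaries in the cycle space *)

Section EvenRingFaces.
Variable m : cmap.
Hypothesis ers : even_ring_system m.
Let pm := ers_plane ers.
Local Notation D := (dart m).
Implicit Types (x y z d : D) (s : D -> bool).

Definition vertex_even s :=
  forall x, \big[addb/false]_(y | same_vertex x y) s y = false.

(** The guard drops the last term at a vertex of degree 2, where [node (node x)] is [x] again. *)
Lemma vertex_sum s x :
  \big[addb/false]_(y | same_vertex x y) s y =
  s x (+) s (node x) (+) ((node (node x) != x) && s (node (node x))).
Proof.
rewrite (eq_bigl (fun y => y \in traject (@node m) x (deg x))); last by move=> y; rewrite same_vertexE.
have := orbit_uniq (@node m) x; rewrite /orbit -/(deg x) => un; rewrite -big_uniq //= {un}.
have := iter_deg ers x; case: (deg23 ers x) => d2; rewrite d2 /= => xE.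
  by rewrite xE eqxx /= !big_cons big_nil !addbF.
have -> : node (node x) != x.
  have := orbit_uniq (@node m) x; rewrite /orbit -/(deg x) d2 /= !inE.
  by case/andP => /norP[_]; rewrite eq_sym.
by rewrite !big_cons big_nil !addbF addbA.
Qed.

(** No face is on both sides of an edge, so the union in [face_edges] is an exclusive or: the
    coboundary of the indicator of the face. *)
Lemma in_face_edges x d :
  (d \in face_edges x) = same_face x d (+) same_face x (edge d).
Proof.
rewrite inE; case: (boolP (same_face x d)) => //= xd.
by rewrite (same_face_l pm xd) (negbTE (same_face_edge ers d)).
Qed.

Lemma in_face_edges_edge x d : (edge d \in face_edges x) = (d \in face_edges x).
Proof. by rewrite !inE (edgeK pm) orbC. Qed.

Lemma vertex_even_coboundary (g : D -> bool) :
  (forall x, g (face x) = g x) -> vertex_even (fun x => g x (+) g (edge x)).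
Proof.
move=> gf x; rewrite big_split /=.
rewrite [X in _ (+) X](eq_bigr (fun y => g (node y))) => [|y _]; last by rewrite -(gf (edge y)) face_edge.
rewrite [X in X (+) _](reindex_inj (node_inj pm)) /=.
rewrite (eq_bigl (fun y => same_vertex x y)) ?addbb // => y.
by rewrite /same_vertex -same_fconnect1_r //; exact: node_inj.
Qed.

Lemma vertex_even_face x : vertex_even [in face_edges x].
Proof.
move=> y; rewrite (eq_bigr (fun z => same_face x z (+) same_face x (edge z))).
  by apply: vertex_even_coboundary => z; rewrite -(same_face_r pm _ (same_face1 z)).
by move=> z _; rewrite -in_face_edges.
Qed.

Lemma face_edges_corner x z w : w \in face_edges x -> same_vertex z w ->
  exists2 y, same_vertex z y & same_face x y.
Proof.
rewrite inE => /orP[xw|xw] zw; first by exists w.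
exists (node w); first exact: same_vertex_trans zw (same_vertex1 w).
by rewrite -(same_face_r pm _ (same_face_node pm w)).
Qed.

(* A face visits each vertex once, so an even subset of its edges propagates
   all the way around it. *)
Lemma face_edges_minimal x (t : D -> bool) d :
  (forall z, t (edge z) = t z) -> vertex_even t ->
  (forall z, t z -> z \in face_edges x) -> t d ->
  forall z, t z = (z \in face_edges x).
Proof.
move=> te tv tx td.
have step z : same_face x z -> t z -> t (face z).
  move=> xz tz; have := tv (edge z); rewrite vertex_sum te tz -/(face z).
  have xf : same_face x (face z) by rewrite -(same_face_r pm _ (same_face1 z)).
  (* A third edge at this vertex belongs to the boundary of the face only if the face has a second
     corner here or lies on both sides of [z]. *)
  suff -> : (node (face z) != edge z) && t (node (face z)) = false.
    by case: (t (face z)).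
  apply/negP => /andP[ne /tx]; rewrite inE => /orP[xn|xn].
    have := corner_inj ers (same_vertex1 (face z)); rewrite -(same_face_l pm xf) => /(_ xn) h.
    by have := node_neq ers (face z); rewrite -h eqxx.
  have nn := node_order3 ers ne.
  rewrite (same_face_r pm _ (same_face_node pm _)) nn in xn.
  case/negP: (same_face_edge ers z).
  by rewrite -(same_face_l pm xz).
have [d1 xd1 td1] : exists2 d1, same_face x d1 & t d1.
  by have := tx _ td; rewrite inE => /orP[xd|xd]; [exists d | exists (edge d); rewrite ?te].
have all z : same_face d1 z -> t z.
  case/connectP=> p + ->; elim: p d1 xd1 td1 {td} => //= a p IH b xb tb.
  case/andP=> /eqP <-; apply: IH; last exact: step.
  by rewrite -(same_face_r pm _ (same_face1 b)).
move=> z; apply/idP/idP; first exact: tx.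
rewrite inE !(same_face_l pm xd1) => /orP[/all//|/all].
by rewrite te.
Qed.

End EvenRingFaces.

Section CersFaces.
Variable m : cmap.
Hypotheses (ers : even_ring_system m) (dt : dual_is_tree m).
Let pm := ers_plane ers.
Local Notation D := (dart m).
Implicit Types (x y z d : D).

(** At an end of an inner edge the outer face occupies the corner opposite to the edge, so [x] must
    be one of its sides. If the edge is on the outer face and [x] is not its inner face f, then at
    each end the edge off the outer face is shared by [x] and f; the two are the same edge, which is
    then parallel to the given one. *)
Lemma face_edges_chordless x z w1 w2 : ~~ on_outer x ->
  w1 \in face_edges x -> same_vertex z w1 ->
  w2 \in face_edges x -> same_vertex (edge z) w2 -> z \in face_edges x.
Proof.
move=> ox h1 v1 h2 v2.
have [y1 zy1 xy1] := face_edges_corner ers h1 v1.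
have [y2 zy2 xy2] := face_edges_corner ers h2 v2.
have wl z' a b : on_outer z' -> same_vertex z' a -> same_face x a ->
    same_vertex (edge z') b -> same_face x b -> z' \in face_edges x.
  move=> oz' va xa vb xb; rewrite inE; apply: contraT => /norP[nz nez].
  have sv c e : same_vertex c e -> same_face x e -> ~~ same_face x c ->
      ~~ same_face x (edge c) -> [/\ e = node (node c), node e = c & node c != c].
    move=> ce xe nc nec; case/(same_vertex3 ers): (ce) => eE.
    - by rewrite -eE xe in nc.
    - by rewrite (same_face_r pm _ (same_face_node pm _)) -eE xe in nec.
    - rewrite eE node_order3 ?(node_neq ers) //.
      by apply: contraNneq nc => <-; rewrite -eE.
  have [aE an _] := sv _ _ va xa nz nez.
  have := sv _ _ vb xb nez; rewrite (edgeK pm) => /(_ nz)[bE bn _].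
  have fa : same_face (edge (node z')) x.
    rewrite (same_face_l pm (same_face_node pm _)) -aE (same_face_sym pm).
    by rewrite xa.
  have oe := on_outer_edgeN ers oz'.
  have fb : same_face (edge b) (edge z').
    by rewrite (same_face_l pm (same_face_node pm _)) bn same_face_refl.
  have h : node z' = edge b.
    apply: (shared_edge_uniq ers dt).
    - by rewrite -(on_outer_same pm (same_face_node pm z')).
    - by rewrite (on_outer_same pm fa).
    - rewrite -(same_face_l pm (same_face_node pm z')) (same_face_sym pm).
      exact: fb.
    - by rewrite (edgeK pm) (same_face_l pm fa).
  have := simple_eq ers (same_vertex1 z'); rewrite h (edgeK pm) => /(_ vb) zE.
  by have := node_neq ers z'; rewrite h -zE eqxx.
case/or3P: (outer_corner ers dt z) => o.
- exact: wl o zy1 xy1 zy2 xy2.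
- rewrite -(on_outer_edge pm) in o; rewrite -in_face_edges_edge //.
  by apply: wl o zy2 xy2 _ xy1; rewrite (edgeK pm).
- rewrite inE; apply/orP; case/(same_vertex3 ers): zy1 => yE.
  + by left; rewrite -yE.
  + by right; rewrite (same_face_r pm _ (same_face_node pm _)) -yE.
  + by move: ox; rewrite (on_outer_same pm xy1) yE o.
Qed.
End CersFaces.

Section UnderlyingIso.
Variables (m1 m2 : cmap) (f : dart m1 -> dart m2) (g : dart m2 -> dart m1).
Hypotheses (c1 : CERS m1) (c2 : CERS m2).
Hypotheses (fK : cancel f g) (gK : cancel g f) (fe : forall d, f (edge d) = edge (f d))
  (fv : forall d e, same_vertex (f d) (f e) = same_vertex d e).

(* The image of an inner face is a sum of inner faces; it has no chord, so
   no two of these are adjacent, and minimality leaves a single one. *)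
Lemma underlying_iso_face x : ~~ on_outer x ->
  exists2 y, ~~ on_outer y & f @: face_edges x = face_edges y.
Proof.
case: c1 c2 => er1 dt1 [er2 dt2] ox.
have pm1 := ers_plane er1; have pm2 := ers_plane er2.
have fi := can_inj fK; have gi := can_inj gK.
have ge d : g (edge d) = edge (g d) by rewrite -{1}(gK d) -fe fK.
pose s z := g z \in face_edges x.
have sE z : s (edge z) = s z by rewrite /s ge in_face_edges_edge.
have transp (t : dart m1 -> bool) z :
   \big[addb/false]_(y | same_vertex (f z) y) t (g y) =
   \big[addb/false]_(y | same_vertex z y) t y.
  rewrite (reindex f); last by exists g => ? _.
  by apply: eq_big => [y|y _]; rewrite ?fv ?fK.
have sv z : \big[addb/false]_(y | same_vertex z y) s y = false.
  by rewrite -(gK z) transp; apply: vertex_even_face.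
have [h0 [h0f h0s]] := face_sum_of_vertex_even pm2 sE sv.
pose h z := h0 z (+) h0 (outer m2).
have hf z : h (face z) = h z by rewrite /h h0f.
have hs z : s z = h z (+) h (edge z).
  by rewrite h0s /h; do 3!case: (h0 _).
have hsf y z : same_face y z -> h y = h z by apply: fconnect_const.
have ho z : on_outer z -> h z = false.
  by move=> /hsf <-; rewrite /h addbb.
have hn z : h (edge z) = h (node z) by rewrite -hf face_edge.
have noadj z : h z -> h (edge z) = false.
  move=> hz; apply/negP => hez.
  have sz : s z = false by rewrite hs hz hez.
  (* When both sides of an edge are in the sum, the third corner at its end is outer, so an edge of
     the image leaves from there. With this at both ends, [z] is a chord. *)
  have far y : h y -> h (edge y) -> exists2 w, same_vertex y w & s w.
    move=> hy hey; have := outer_corner er2 dt2 y.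
    have no w : h w -> on_outer w = false by move=> hw; apply/negP => /ho; rewrite hw.
    rewrite no // no -?hn //= => ow.
    exists (node (node y)); first exact: same_vertex_trans (same_vertex1 y) (same_vertex1 _).
    rewrite hs hn ho // node_order3 ?hy //.
    by apply: contraTneq ow => ->; rewrite no.
  have [w1 v1 s1] := far z hz hez.
  have [w2 v2 s2] : exists2 w, same_vertex (edge z) w & s w.
    by apply: far => //; rewrite (edgeK pm2).
  rewrite -(gK w1) -(gK z) fv in v1; rewrite -(gK w2) -(gK z) -fe fv in v2.
  have := face_edges_chordless er1 dt1 ox s1 v1 s2 v2.
  by rewrite -[_ \in _]/(s z) sz.
have [y hy] : exists y, h y.
  have: s (f x) by rewrite /s fK inE same_face_refl.
  by rewrite hs; case: (boolP (h (f x))) => [|_ /=] hx; [exists (f x) | exists (edge (f x))].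
exists y; first by apply: contraTN hy => /ho->.
have sub z : z \in face_edges y -> s z.
  rewrite inE hs => /orP[/hsf|/hsf] yz.
    by rewrite noadj -yz hy.
  by rewrite -(edgeK pm2 z) (edgeK pm2 (edge z)) noadj -yz hy.
have min : forall z, f z \in face_edges y = (z \in face_edges x).
  apply: (face_edges_minimal er1 (t := fun z => f z \in face_edges y) (d := g y)).
  - by move=> z; rewrite fe in_face_edges_edge.
  - move=> z; rewrite -transp -[RHS](vertex_even_face er2 y (f z)).
    by apply: eq_bigr => w _; rewrite gK.
  - by move=> z /sub; rewrite /s fK.
  - by rewrite gK inE same_face_refl.
by apply/setP => z; rewrite -(gK z) mem_imset // min.
Qed.
End UnderlyingIso.

Lemma underlying_iso_resonance m1 m2 : CERS m1 -> CERS m2 ->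
  underlying_iso m1 m2 -> resonance_iso m1 m2.
Proof.
move=> c1 c2 [f [[g fK gK] fe fv]].
have ge d : g (edge d) = edge (g d) by rewrite -{1}(gK d) -fe fK.
have gv d e : same_vertex (g d) (g e) = same_vertex d e by rewrite -fv !gK.
by apply: (resonance_iso_of_faces fK gK fe fv) => x; apply: underlying_iso_face.
Qed.

Lemma transformation1_resonance m1 m2 : transformation1 m1 m2 -> resonance_iso m1 m2.
Proof.
move=> [[er1 _] [er2 _] [[d [_ h]]|[d [_ h]]]].
  apply: graph_iso_trans (map_iso_resonance (ers_plane er2) h).
  exact: subdiv_resonance (ers_plane er1).
apply/graph_iso_sym; apply: graph_iso_trans (map_iso_resonance (ers_plane er1) h).
exact: subdiv_resonance (ers_plane er2).
Qed.

Lemma transformation1_closure m1 m2 : CERS m1 ->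
  clos_refl_trans cmap transformation1 m1 m2 -> CERS m2 /\ resonance_iso m1 m2.
Proof.
move=> c1 h; elim: h c1 => [G H [cG cH t] _|G cG|G H K _ IH1 _ IH2 cG].
- by split=> //; apply: transformation1_resonance.
- by split=> //; apply: graph_iso_refl.
- have [cH i1] := IH1 cG; have [cK i2] := IH2 cH.
  by split=> //; apply: graph_iso_trans i1 i2.
Qed.

Lemma resonantly_equivalent_resonance m1 m2 : CERS m1 -> CERS m2 ->
  resonantly_equivalent m1 m2 -> resonance_iso m1 m2.
Proof.
move=> c1 c2 [n1 [n2 [/(transformation1_closure c1)[d1 i1]]]].
move=> /(transformation1_closure c2)[d2 i2] u.
apply: graph_iso_trans i1 _; apply: graph_iso_trans (graph_iso_sym i2).
exact: underlying_iso_resonance.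
Qed.

(** * Up-sets of zigzag posets *)

Definition hdist n (w v : {ffun 'I_n -> bool}) := #|[set i | w i != v i]|.
Definition flip n (w : {ffun 'I_n -> bool}) (i : 'I_n) : {ffun 'I_n -> bool} :=
  [ffun j => w j (+) (j == i)].

Definition fence_pair (b x y : bool) := if b then y ==> x else x ==> y.
Definition fence_word n (s : nat -> bool) (w : {ffun 'I_n -> bool}) :=
  [forall i : 'I_n, forall j : 'I_n, (j == i.+1 :> nat) ==> fence_pair (s i) (w i) (w j)].

(* The up-sets of the zigzag poset on 0, ..., n-1 in which consecutive elements
   are comparable, in the direction given by s. *)
Definition fence n (s : nat -> bool) := {w : {ffun 'I_n -> bool} | fence_word s w}.
Definition fence_adj n s : rel (fence n s) := fun a b => hdist (val a) (val b) == 1.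

(** * Hamming distance on words *)

Section Hamming.
Variable n : nat.
Implicit Types (w v u : {ffun 'I_n -> bool}) (i j : 'I_n).

Lemma hdist_eq0 w v : (hdist w v == 0) = (w == v).
Proof.
rewrite cards_eq0; apply/eqP/eqP => [h|->]; last by apply/setP => i; rewrite !inE eqxx.
by apply/ffunP => i; apply/eqP; move/setP/(_ i): h; rewrite !inE => /negbFE.
Qed.

Lemma hdist_sym w v : hdist w v = hdist v w.
Proof. by apply: eq_card => i; rewrite !inE eq_sym. Qed.

Lemma hdist_triangle w v u : hdist w u <= hdist w v + hdist v u.
Proof.
apply: leq_trans (leq_card_setU _ _); apply/subset_leq_card/subsetP => i.
by rewrite !inE; case: (w i); case: (v i); case: (u i).
Qed.

Lemma hdist_flip w v i :
  hdist w (flip v i) + (w i != v i) = hdist w v + (w i == v i).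
Proof.
rewrite /hdist (cardsD1 i [set j | w j != v j]) (cardsD1 i [set j | w j != flip v i j]).
rewrite !inE ffunE eqxx addbT.
have -> : [set j | w j != flip v i j] :\ i = [set j | w j != v j] :\ i.
  by apply/setP => j; rewrite !inE ffunE; case: eqP => //= _; rewrite addbF.
by case: (w i); case: (v i); rewrite /= ?addn0 ?addn1 ?add0n ?add1n.
Qed.

Lemma hdist_flip1 w i : hdist w (flip w i) = 1.
Proof.
have := hdist_flip w w i; rewrite eqxx addn0 => ->.
by have /eqP -> : hdist w w == 0 by rewrite hdist_eq0.
Qed.

Lemma hdist1P w v : hdist w v = 1 -> exists i, v = flip w i.
Proof.
move/eqP/cards1P => [i /setP h]; exists i; apply/ffunP => j; rewrite ffunE.
by have := h j; rewrite !inE; case: (w j); case: (v j); case: (j == i).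
Qed.

(** Expresses a coordinate through distances alone, so that isometries can transport it. *)
Lemma hdist_half w v i : (hdist w v < hdist w (flip v i)) = (w i == v i).
Proof. by have := hdist_flip w v i; case: (w i == v i); lia. Qed.

Lemma flip_at w i : flip w i i = ~~ w i. Proof. by rewrite ffunE eqxx addbT. Qed.
Lemma flip_other w i j : j != i -> flip w i j = w j.
Proof. by move=> /negbTE h; rewrite ffunE h addbF. Qed.
End Hamming.

Section Fence.
Variables (n : nat) (s : nat -> bool).
Local Notation word := {ffun 'I_n -> bool}.
Implicit Types (w v : word) (i j k : 'I_n).

Lemma fence_wordP w :
  reflect (forall i j, j = i.+1 :> nat -> fence_pair (s i) (w i) (w j)) (fence_word s w).
Proof.
apply: (iffP forallP) => [h i j ji|h i].
  by have /forallP/(_ j) := h i; rewrite ji eqxx.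
by apply/forallP => j; apply/implyP => /eqP; apply: h.
Qed.

Lemma fence_const b : fence_word s ([ffun=> b] : word).
Proof. by apply/fence_wordP => i j _; rewrite !ffunE /fence_pair; case: (s i) b => -[]. Qed.

(** A word that changes only between [k] and [k.+1] has to satisfy just the constraint there. These
    words, and those of the next lemma, refute every comparability that the pattern does not
    force. *)
Lemma fence_step_lo (k : nat) : s k -> fence_word s ([ffun i : 'I_n => i <= k] : word).
Proof.
move=> sk; apply/fence_wordP => i j ji; rewrite !ffunE ji /fence_pair.
case: (boolP (s i)) => si; apply/implyP => h; first exact: ltnW.
by rewrite ltn_neqAle h andbT; apply: contraNneq si => ->.
Qed.

Lemma fence_step_hi (k : nat) : ~~ s k -> fence_word s ([ffun i : 'I_n => k < i] : word).
Proof.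
move=> sk; apply/fence_wordP => i j ji; rewrite !ffunE ji /fence_pair ltnS.
case: (boolP (s i)) => si; apply/implyP => h; last exact: ltnW.
by rewrite ltn_neqAle h andbT; apply: contraNneq sk => ->.
Qed.

(* Any two words are joined by a geodesic: move right from the first
   difference to the last position that can be flipped from the left. *)
Lemma fence_geodesic w v : fence_word s w -> fence_word s v -> w != v ->
  exists2 i, w i != v i & fence_word s (flip w i).
Proof.
move=> /fence_wordP hw /fence_wordP hv nwv.
have [i0 d0] : exists i, w i != v i.
  apply/existsP; apply: contraNT nwv; rewrite negb_exists => /forallP h.
  by apply/eqP/ffunP => i; apply/eqP; rewrite -[_ == _]negbK h.
pose P i := (w i != v i) && [forall k : 'I_n, (i == k.+1 :> nat) ==> fence_pair (s k) (w k) (v i)].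
have [i1 Pi1] : exists i, P i.
  case: (@arg_minnP _ i0 (fun i => w i != v i) (fun i => i : nat) d0) => i di imin.
  exists i; rewrite /P di; apply/forallP => k; apply/implyP => /eqP ik.
  have -> : w k = v k.
    by apply/eqP; rewrite -[_ == _]negbK; apply/negP => /imin /=; rewrite ik ltnn.
  exact: hv.
case: (@arg_maxnP _ i1 P (fun i => i : nat) Pi1) => i /andP[di /forallP li] imax.
exists i => //; have fi : flip w i i = v i.
  by rewrite flip_at; move: di; case: (w i); case: (v i).
apply/fence_wordP => k j jk.
case: (eqVneq j i) => [ji|ji].
  rewrite ji fi flip_other; last by apply/eqP => ki; move: jk; rewrite ji ki; lia.
  by have := li k; rewrite -ji jk eqxx.
case: (eqVneq k i) => [ki|ki]; last by rewrite !flip_other //; apply: hw.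
rewrite ki in jk *; rewrite fi flip_other //.
case: (eqVneq (w j) (v j)) => [->|dj]; first exact: hv.
apply: contraT => bad; have : P j.
  rewrite /P dj; apply/forallP => k'; apply/implyP => /eqP jk'.
  have -> : k' = i by apply: ord_inj; lia.
  by move: bad di dj; rewrite /fence_pair; case: (s i); case: (w i); case: (v i);
     case: (w j); case: (v j).
by move/imax => /=; rewrite jk ltnn.
Qed.

(** A geodesic from the all-false word to the all-true word has to flip every coordinate. *)
Lemma fence_edge i : exists2 w, fence_word s w & fence_word s (flip w i).
Proof.
have h : forall d w v, fence_word s w -> fence_word s v -> w i != v i -> hdist w v <= d ->
    exists2 w, fence_word s w & fence_word s (flip w i).
  elim=> [|d IH] w v hw hv nwv.
    by rewrite leqn0 hdist_eq0 => /eqP wv; rewrite wv eqxx in nwv.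
  have [|k dk hk] := fence_geodesic hw hv; first by apply: contraNneq nwv => ->.
  case: (eqVneq k i) => [<-|ki] dd; first by exists w.
  apply: (IH _ _ hk hv); first by rewrite flip_other // eq_sym.
  have := hdist_flip v w k; rewrite [v k == _]eq_sym (negbTE dk) /= !(hdist_sym v); lia.
apply: (h _ [ffun=> false] [ffun=> true]); rewrite ?fence_const ?ffunE //.
Qed.

(** The order of the zigzag poset, recovered from its up-sets. *)
Definition fle i j := forall w, fence_word s w -> w i -> w j.

Lemma fle_up i j : i < j -> (forall k, i <= k < j -> ~~ s k) -> fle i j.
Proof.
move=> ij h w /fence_wordP hw wi.
have {}h : forall d (k : 'I_n), k = i + d :> nat -> k <= j -> w k.
  elim=> [|d IH] k kE kj; first by have -> : k = i by apply: ord_inj; lia.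
  have dn : i + d < n by have := ltn_ord k; lia.
  have := hw (Ordinal dn) k; rewrite /fence_pair (negbTE (h _ _)) /=; last by lia.
  by move=> H; have /implyP := H ltac:(lia); apply; apply: IH => //=; lia.
by apply: (h (j - i)); lia.
Qed.

Lemma fle_down i j : i < j -> (forall k, i <= k < j -> s k) -> fle j i.
Proof.
move=> ij h w /fence_wordP hw wj.
have {}h : forall d (k : 'I_n), k + d = j :> nat -> i <= k -> w k.
  elim=> [|d IH] k kE ik; first by have -> : k = j by apply: ord_inj; lia.
  have dn : k.+1 < n by have := ltn_ord j; lia.
  have := hw k (Ordinal dn); rewrite /fence_pair h /=; last by lia.
  by move=> H; have /implyP := H erefl; apply; apply: IH => //=; lia.
by apply: (h (j - i)); lia.
Qed.

Lemma fle_upE i j : i < j -> fle i j -> forall k, i <= k < j -> ~~ s k.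
Proof.
move=> ij h k /andP[ik kj]; apply/negP => sk.
by have := h _ (fence_step_lo sk); rewrite !ffunE ik leqNgt kj => /(_ isT).
Qed.

Lemma fle_downE i j : i < j -> fle j i -> forall k, i <= k < j -> s k.
Proof.
move=> ij h k /andP[ik kj]; apply: contraT => sk.
by have := h _ (fence_step_hi sk); rewrite !ffunE kj ltnNge ik => /(_ isT).
Qed.

Definition fcomp i j := fle i j \/ fle j i.
(** Symmetric in [i] and [j], because an isomorphism of resonance graphs may reverse the order. *)
Definition fcover i j :=
  [/\ i <> j, fcomp i j & forall k, k <> i -> k <> j ->
        ~ ((fle i k /\ fle k j) \/ (fle j k /\ fle k i))].

Lemma fcomp_adjacent i j : j = i.+1 :> nat -> fcomp i j.
Proof.
move=> ji; have ij : i < j by rewrite ji.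
case: (boolP (s i)) => si; [right; apply: fle_down | left; apply: fle_up] => // k;
  rewrite ji ltnS -eqn_leq => /eqP <- //.
Qed.

Lemma fcover_sym i j : fcover i j -> fcover j i.
Proof.
case=> ij ji h; split; [by move/esym | by case: ji; [right | left] |].
by move=> k kj ki H; apply: (h k) => //; case: H; [right | left].
Qed.

(** An element strictly between two neighbours would lie to one side of both, and the pattern at the
    step next to it would have to go up and down at once. *)
Lemma fcover_adjacent i j : j = i.+1 :> nat -> fcover i j.
Proof.
move=> ji; split; [by move=> ij; move: ji; rewrite ij; lia | exact: fcomp_adjacent |].
move=> k ki kj.
have nk : k < i \/ j < k.
  have : nat_of_ord k <> i by move=> h; apply: ki; apply: ord_inj.
  have : nat_of_ord k <> j by move=> h; apply: kj; apply: ord_inj.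
  lia.
have contr (a b c : 'I_n) : a < b -> a < c -> fle a b -> fle c a -> False.
  move=> ab ac /(fle_upE ab)/(_ a) h1 /(fle_downE ac)/(_ a) h2.
  by move: h1 h2; rewrite leqnn ab ac => /(_ isT)/negP h /(_ isT).
have contr' (a b c : 'I_n) : b < a -> c < a -> fle b a -> fle a c -> False.
  move=> ba ca /(fle_upE ba) h1 /(fle_downE ca) h2.
  have an : a.-1 < n by have := ltn_ord a; lia.
  by have /negP := h1 (Ordinal an) ltac:(rewrite /=; lia); apply; apply: h2; rewrite /=; lia.
case: nk => nk [] [h1 h2].
- by apply: (contr k j i) => //; rewrite ji; lia.
- by apply: (contr k i j) => //; rewrite ji; lia.
- by apply: (contr' k i j) => //; rewrite -ji; lia.
- by apply: (contr' k j i) => //; rewrite -ji; lia.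
Qed.

(** Comparability over a longer range forces a constant pattern there, and then [i.+1] lies strictly
    between. *)
Lemma fcover_adjacentE i j : i < j -> fcover i j -> j = i.+1 :> nat.
Proof.
move=> ij [_ cij H]; apply/eqP; rewrite eqn_leq ij andbT leqNgt; apply/negP => ij2.
have kn : i.+1 < n by apply: ltn_trans ij2 _.
apply: (H (Ordinal kn)) => [/(congr1 val)|/(congr1 val)|] /=; try lia.
case: cij => h; [left | right].
  have u := fle_upE ij h.
  by split; apply: fle_up => //= k hk; apply: u; lia.
have u := fle_downE ij h.
by split; apply: fle_down => //= k hk; apply: u; lia.
Qed.

(** The form in which the pattern is read off the poset: comparability ignores the direction of the
    order, so it sees equality of signs and not the signs themselves. *)
Lemma fcomp_skip i j : j = i.+2 :> nat -> fcomp i j <-> s i = s i.+1.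
Proof.
move=> ji; have ij : i < j by rewrite ji; lia.
have kn : i.+1 < n by have := ltn_ord j; lia.
split=> [[h|h]|h].
- have u := fle_upE ij h; have := u i; have := u (Ordinal kn) => /=.
  rewrite leqnn ij ji leqnSn ltnS leqnn => /(_ isT)/negbTE-> /(_ isT)/negbTE->; done.
- have u := fle_downE ij h; have := u i; have := u (Ordinal kn) => /=.
  rewrite leqnn ij ji leqnSn ltnS leqnn => /(_ isT)-> /(_ isT)->; done.
have kE (k : 'I_n) : i <= k < j -> s k = s i.
  move=> kij; have [->//|->] : k = i :> nat \/ k = i.+1 :> nat by lia.
  by rewrite h.
case: (boolP (s i)) => si; [right; apply: fle_down | left; apply: fle_up] => // k /kE -> //.
Qed.
End Fence.

(** * Isomorphisms between graphs of up-sets *)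

Section Rigidity.
Variables (n n' : nat) (s s' : nat -> bool).

(** Hamming geodesics stay inside the fence, so a homomorphism sends their steps to steps and the
    triangle inequality applies. *)
Lemma fence_hom_hdist (f : fence n s -> fence n' s') :
  (forall a b, fence_adj a b -> fence_adj (f a) (f b)) ->
  forall a b, hdist (val (f a)) (val (f b)) <= hdist (val a) (val b).
Proof.
move=> hf a b; have [d] := ubnP (hdist (val a) (val b)).
elim: d a => // d IH a ad.
case: (eqVneq (val a) (val b)) => [/val_inj ->|nab].
  by have /eqP -> : hdist (val (f b)) (val (f b)) == 0 by rewrite hdist_eq0.
have [i di vi] := fence_geodesic (valP a) (valP b) nab.
pose c : fence n s := Sub (flip (val a) i) vi.
have ac : hdist (val (f a)) (val (f c)) = 1.
  by apply/eqP/(hf a c); rewrite /fence_adj /= hdist_flip1.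
have cb : hdist (val c) (val b) < hdist (val a) (val b).
  have := hdist_flip (val b) (val a) i.
  by rewrite !(hdist_sym _ (val b)) /= [_ == sval a i]eq_sym (negbTE di) /=; lia.
apply: leq_trans (hdist_triangle _ (val (f c)) _) _; rewrite ac.
exact: leq_ltn_trans (IH c (leq_trans cb ad)) cb.
Qed.

(* A graph isomorphism is a Hamming isometry, hence permutes the half-spaces
   cut out by the coordinates: it is a signed coordinate permutation. *)
Lemma fence_iso_coord (f : fence n s -> fence n' s') :
  (forall a b, hdist (val (f a)) (val (f b)) = hdist (val a) (val b)) ->
  forall i, exists j, exists e, forall z, val (f z) j = val z i (+) e.
Proof.
move=> iso i; have [w hw hw'] := fence_edge s i.
pose a : fence n s := Sub w hw; pose c : fence n s := Sub (flip w i) hw'.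
have [j fj] : exists j, val (f c) = flip (val (f a)) j.
  by apply: hdist1P; rewrite iso /= hdist_flip1.
exists j, (val a i (+) val (f a) j) => z.
have := hdist_half (val (f z)) (val (f a)) j; rewrite -fj !iso hdist_half.
by move: (val (f z) j) (val z i) (val a i) (val (f a) j) => -[] [] [] [].
Qed.
End Rigidity.

(** The first step fixes a direction, injectivity forbids turning back, and the range leaves room
    for a single offset. *)
Lemma adjacent_perm n (p : 'I_n -> 'I_n) : injective p ->
  (forall i j : 'I_n, j = i.+1 :> nat -> p j = (p i).+1 :> nat \/ p i = (p j).+1 :> nat) ->
  (forall i, p i = i :> nat) \/ (forall i, p i + i = n.-1 :> nat).
Proof.
case: n p => [|n] p pi h; first by left => -[].
pose q k : nat := p (inord k).
have qi k l : k <= n -> l <= n -> q k = q l -> k = l.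
  by move=> kn ln /ord_inj/pi/(congr1 val) /=; rewrite !inordK.
have hq k : k < n -> q k.+1 = (q k).+1 \/ q k = (q k.+1).+1.
  by move=> kn; apply: h; rewrite !inordK // ltnS ltnW.
have qn k : q k <= n by rewrite -ltnS ltn_ord.
have pq i : p i = q i :> nat by rewrite /q inord_val.
case: (ltnP 0 n) => [n0|]; last first.
  by rewrite leqn0 => /eqP n0; left => i; have := ltn_ord i; have := qn i; rewrite pq; lia.
case: (hq 0 n0) => h0.
  have {}h k : k < n -> q k.+1 = (q k).+1.
    elim: k => // k IH kn; case: (hq _ kn) => // hk.
    have := IH (ltnW kn); rewrite hk => /succn_inj/qi; lia.
  have {}h k : k <= n -> q k = q 0 + k.
    by elim: k => [|k IH] kn; rewrite ?addn0 // h // IH ?addnS // ltnW.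
  left => i; have := h n (leqnn n); have := qn n.
  have in_ : i <= n by rewrite -ltnS ltn_ord.
  by rewrite pq (h _ in_); lia.
have {}h k : k < n -> q k = (q k.+1).+1.
  elim: k => // k IH kn; case: (hq _ kn) => // hk.
  have := IH (ltnW kn); rewrite -hk => /qi; lia.
have {}h k : k <= n -> q k + k = q 0.
  by elim: k => [|k IH] kn; rewrite ?addn0 // -(IH (ltnW kn)) addnS (h k kn).
right => i; have := h n (leqnn n); have := qn 0; rewrite pq /= => h1 h2.
have in_ : i <= n by rewrite -ltnS ltn_ord.
by rewrite (h _ in_); lia.
Qed.

Theorem fence_rigid n n' s s' :
  graph_iso (@fence_adj n s) (@fence_adj n' s') ->
  n = n' /\
  ((forall i, i.+2 < n -> (s i == s i.+1) = (s' i == s' i.+1)) \/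
   (forall i, i.+2 < n -> (s i == s i.+1) = (s' (n - i.+3) == s' (n - i.+3).+1))).
Proof.
move=> [f [[g fK gK] fa]].
have ga a b : fence_adj (g a) (g b) = fence_adj a b by rewrite -fa !gK.
have iso a b : hdist (val (f a)) (val (f b)) = hdist (val a) (val b).
  apply/eqP; rewrite eqn_leq fence_hom_hdist => [|x y]; last by rewrite fa.
  rewrite -{1}(fK a) -{1}(fK b) fence_hom_hdist // => x y; by rewrite ga.
have iso' a b : hdist (val (g a)) (val (g b)) = hdist (val a) (val b).
  by rewrite -iso !gK.
have inj m m' t t' (h : fence m t -> fence m' t') p e :
    (forall i z, val (h z) (p i) = val z i (+) e i) -> injective p.
  move=> hp i j pij; apply/eqP; apply: contraT => nij.
  have [w hw hw'] := fence_edge t j.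
  pose a : fence m t := Sub w hw; pose c : fence m t := Sub (flip w j) hw'.
  have ai := hp i a; have aj := hp j a; have ci := hp i c; have cj := hp j c.
  rewrite pij in ai ci; move: ai aj ci cj => -> + ->.
  rewrite /= flip_at flip_other //.
  by do 2!case: (w _); do 2!case: (e _).
have [p /fin_all_exists[e pe]] := fin_all_exists (fence_iso_coord iso).
have [q /fin_all_exists[e' qe]] := fin_all_exists (fence_iso_coord iso').
have pinj := inj _ _ _ _ _ _ _ pe; have qinj := inj _ _ _ _ _ _ _ qe.
have nn : n = n'.
  apply/eqP; rewrite eqn_leq; have := leq_card _ pinj; have := leq_card _ qinj.
  by rewrite !card_ord => -> ->.
split=> //; move: f g fK gK fa ga iso iso' p e pe pinj q e' qe qinj; rewrite -nn {n' nn}.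
move=> f g fK gK _ _ _ _ p e pe pinj _ _ _ _.
have fg (z : fence n s') i : val z (p i) = val (g z) i (+) e i by rewrite -pe gK.
(* The preimage of the constant word [b] reads [b (+) e k] at [k]. Respecting [i] below [j] for both
   values of [b] forces equal signs; as neighbours are comparable, one sign serves all coordinates
   and [p] preserves or reverses the whole order. *)
have ee i j : fle s i j -> e i = e j.
  move=> ij; pose z b : fence n s' := Sub [ffun=> b] (fence_const n s' b).
  have := ij _ (valP (g (z false))); have := ij _ (valP (g (z true))).
  have := fg (z true) i; have := fg (z true) j; have := fg (z false) i; have := fg (z false) j.
  have zE b k : val (z b) k = b by rewrite ffunE.
  rewrite !zE; move: (val (g (z true)) i) (val (g (z true)) j) (val (g (z false)) i)
    (val (g (z false)) j) (e i) (e j) => -[] [] [] [] [] [] // _ _ _ _ h1 h2;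
  by [have := h1 isT | have := h2 isT].
have e1 i j : e i = e j.
  have h k (j' : 'I_n) : j' = k :> nat -> forall j0 : 'I_n, j0 = 0 :> nat -> e j' = e j0.
    elim: k j' => [|k IH] j' jk j0 j00; first by congr e; apply: ord_inj; rewrite jk j00.
    have kn : k < n by have := ltn_ord j'; lia.
    rewrite -(IH (Ordinal kn) erefl j0 j00).
    have [/ee//|/ee//] : fcomp s (Ordinal kn) j' by apply: fcomp_adjacent.
  have n0 : 0 < n by apply: leq_ltn_trans (ltn_ord i).
  by rewrite (h _ i erefl (Ordinal n0) erefl) (h _ j erefl (Ordinal n0) erefl).
have leE i j : if e i then fle s i j <-> fle s' (p j) (p i) else fle s i j <-> fle s' (p i) (p j).
  have gi (z : fence n s') := fg z i; have gj (z : fence n s') := fg z j.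
  have fi (z : fence n s) := pe i z; have fj (z : fence n s) := pe j z.
  move: gi gj fi fj; rewrite -(e1 i j); case: (e i) => gi gj fi fj; split=> h w hw.
  - pose z : fence n s' := Sub w hw; rewrite -[w]/(val z) gi gj !addbT.
    by apply: contraNN; apply: (h _ (valP (g z))).
  - pose z : fence n s := Sub w hw; have := h _ (valP (f z)); rewrite fi fj !addbT.
    by move/contraNN; rewrite !negbK.
  - pose z : fence n s' := Sub w hw; rewrite -[w]/(val z) gi gj !addbF.
    exact: (h _ (valP (g z))).
  - by pose z : fence n s := Sub w hw; have := h _ (valP (f z)); rewrite fi fj !addbF.
have compE i j : fcomp s i j <-> fcomp s' (p i) (p j).
  have := leE i j; have := leE j i; rewrite (e1 j i) /fcomp; case: (e i); tauto.
have psurj k : exists i, k = p i by have [q' _ qK] := injF_bij pinj; exists (q' k).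
have coverE i j : fcover s i j -> fcover s' (p i) (p j).
  case=> ij cij H; split; [by move/pinj | by apply/compE | ].
  move=> k; have [k' ->] := psurj k => ki kj Hk.
  apply: (H k') => [kE|kE|]; [by apply: ki; rewrite kE | by apply: kj; rewrite kE |].
  move: Hk; have := leE i k'; have := leE k' i; have := leE j k'; have := leE k' j.
  by rewrite (e1 j i) (e1 k' i); case: (e i); tauto.
have [i j ji|pid|prev] := adjacent_perm pinj.
- have /coverE c := fcover_adjacent s ji.
  case: (ltngtP (p i) (p j)) => [lt|lt|/ord_inj/pinj ijE].
  + by left; apply: fcover_adjacentE c.
  + by right; apply: fcover_adjacentE (fcover_sym c).
  + by move: ji; rewrite ijE; lia.
- left=> k kn; have k0 : k < n by lia.
  have := compE (Ordinal k0) (Ordinal kn); rewrite !fcomp_skip ?pid //= => h.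
  by apply/eqP/eqP; tauto.
(* Reversal sends [k] and [k.+2] to [n - k.+1] and [n - k.+3]; the latter is the smaller, so the
   sign pair starts there. *)
- right=> k kn; have k0 : k < n by lia.
  have := compE (Ordinal k0) (Ordinal kn); rewrite fcomp_skip //=.
  have p0 := prev (Ordinal k0); have p2 := prev (Ordinal kn); rewrite /= in p0 p2.
  have -> : fcomp s' (p (Ordinal k0)) (p (Ordinal kn)) <->
            fcomp s' (p (Ordinal kn)) (p (Ordinal k0)) by rewrite /fcomp; tauto.
  rewrite fcomp_skip; last lia.
  have -> : p (Ordinal kn) = n - k.+3 :> nat by lia.
  by move=> h; apply/eqP/eqP; tauto.
Qed.

(** * Labelled chains *)

Section OrbitIndex.
Variables (T : finType) (f : T -> T).
Hypothesis fi : injective f.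
Local Notation order := (fingraph.order f).

Lemma order_fconnect x y : fconnect f x y -> order x = order y.
Proof. by move=> h; apply/eq_card/(same_connect (fconnect_sym fi)). Qed.

Lemma iter_order_inj x i j : i < order x -> j < order x -> iter i f x = iter j f x -> i = j.
Proof. by move=> hi hj h; rewrite -(findex_iter hi) -(findex_iter hj) h. Qed.

Lemma iter_mod_order x k : iter (k %% order x) f x = iter k f x.
Proof.
rewrite {2}(divn_eq k (order x)) addnC iterD; congr iter.
by elim: (k %/ order x) => //= a IH; rewrite mulSn iterD -IH iter_order.
Qed.

Lemma findex_addC x y : fconnect f x y -> x != y -> findex f x y + findex f y x = order x.
Proof.
move=> xy nxy; have lt := findex_max xy.
have p0 : 0 < findex f x y by rewrite lt0n findex_eq0.
have -> : findex f y x = order x - findex f x y; last by rewrite subnKC // ltnW.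
have {1}-> : x = iter (order x - findex f x y) f y.
  by rewrite -{2}(iter_findex xy) -iterD subnK ?iter_order // ltnW.
by rewrite findex_iter // -(order_fconnect xy) ltn_subrL p0 order_gt0.
Qed.
End OrbitIndex.

(** [label_order] makes the two arcs between [u i] and [w i] cover their face exactly once,
    [label_size] puts a dart strictly inside each arc, where it can be lengthened, and
    [label_shared] leaves no further inner edges. *)
Record chain_label (m : cmap) (n : nat) (u w : nat -> dart m) (p q : nat -> nat) : Prop :=
  ChainLabel {
  label_inner : forall i, i < n -> ~~ on_outer (u i);
  label_inj : forall i j, i < n -> j < n -> same_face (u i) (u j) -> i = j;
  label_cover : forall x, ~~ on_outer x -> exists2 i, i < n & same_face (u i) x;
  label_to : forall i, i < n -> iter (p i) (@face m) (u i) = w i;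
  label_back : forall i, i < n -> iter (q i) (@face m) (w i) = u i;
  label_order : forall i, i < n -> fingraph.order (@face m) (u i) = p i + q i;
  label_size : forall i, i < n -> 2 <= p i /\ 2 <= q i;
  label_link : forall i, i.+1 < n -> edge (w i) = u i.+1;
  label_shared : forall x, ~~ on_outer x -> ~~ on_outer (edge x) ->
    exists2 i, i.+1 < n & x = w i \/ x = u i.+1 }.

(* The inner faces are f_0, ..., f_(n-1); w i and u i.+1 are the two darts of
   the edge shared by f_i and f_(i+1), and p i, q i are the two distances
   between the darts u i and w i around f_i. The darts u 0 and w n.-1 are
   arbitrary but neither equal nor adjacent to their partners. *)
Definition labelled (m : cmap) (n : nat) (p q : nat -> nat) : Prop :=
  exists u w, @chain_label m n u w p q.

Section LabelBasics.
Variables (m : cmap) (pm : plane_map m) (n : nat) (u w : nat -> dart m) (p q : nat -> nat).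
Hypothesis L : chain_label n u w p q.
Let finj := face_inj pm.

Lemma label_face i : i < n -> same_face (u i) (w i).
Proof. by move=> h; rewrite -(label_to L h); exact: fconnect_iter. Qed.

Lemma label_rev : chain_label n (fun i => w (n - i.+1)) (fun i => u (n - i.+1))
  (fun i => q (n - i.+1)) (fun i => p (n - i.+1)).
Proof.
have lt i : i < n -> n - i.+1 < n by lia.
split.
- by move=> i /lt h; rewrite -(on_outer_same pm (label_face h)) (label_inner L).
- move=> i j hi hj; rewrite -(same_face_l pm (label_face (lt _ hi))).
  by rewrite -(same_face_r pm _ (label_face (lt _ hj))) => /(label_inj L); lia.
- move=> x /(label_cover L)[i hi ix]; exists (n - i.+1); first exact: lt.
  have -> : n - (n - i.+1).+1 = i by lia.
  by rewrite -(same_face_l pm (label_face hi)).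
- by move=> i /lt h; apply: label_back L _ h.
- by move=> i /lt h; apply: label_to L _ h.
- move=> i /lt h; rewrite addnC -(label_order L h).
  by symmetry; apply: order_fconnect finj _ _ (label_face h).
- by move=> i /lt/(label_size L)[].
- move=> i hi; have -> : n - i.+1 = (n - i.+2).+1 by lia.
  by rewrite -(label_link L) ?(edgeK pm) //; lia.
- move=> x h1 h2; case: (label_shared L h1 h2) => i hi h; exists (n - i.+2); first lia.
  have -> : n - (n - i.+2).+1 = i.+1 by lia.
  have -> : n - (n - i.+2).+2 = i by lia.
  by case: h; [right | left].
Qed.

Lemma label_edge_outer i x : i < n -> same_face (u i) x -> x <> u i -> x <> w i ->
  on_outer (edge x).
Proof.
move=> hi ix xu xw; apply: contraT => ox.
have ix' : ~~ on_outer x by rewrite -(on_outer_same pm ix) (label_inner L).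
have [j hj [xE|xE]] := label_shared L ix' ox.
  case: xw; rewrite xE; congr w; apply: (label_inj L) => //; first exact: ltnW.
  by rewrite (same_face_l pm (label_face (ltnW hj))) -xE (same_face_sym pm).
case: xu; rewrite xE; congr u; apply: (label_inj L) => //.
by rewrite -xE (same_face_sym pm).
Qed.
End LabelBasics.

Lemma labelled_ext m n p q p' q' : (forall i, i < n -> p i = p' i) ->
  (forall i, i < n -> q i = q' i) -> labelled m n p q -> labelled m n p' q'.
Proof.
move=> hp hq [u [w L]]; exists u, w; split; try by case: L.
- by move=> i hi; rewrite -hp // (label_to L).
- by move=> i hi; rewrite -hq // (label_back L).
- by move=> i hi; rewrite -hq // -hp // (label_order L).
- by move=> i hi; rewrite -hq // -hp //; apply: label_size L _ hi.
Qed.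

Lemma labelled_rev m n p q : plane_map m -> labelled m n p q ->
  labelled m n (fun i => q (n - i.+1)) (fun i => p (n - i.+1)).
Proof. by move=> pm [u [w L]]; do 2!eexists; apply: label_rev L. Qed.

Section CersCorners.
Variable m : cmap.
Hypothesis cm : CERS m.
Let er := proj1 cm.
Let dt := proj2 cm.
Let pm := ers_plane er.
Local Notation D := (dart m).

(** The vertex between two consecutive inner edges of an inner face would have no outer corner.
    Hence marked darts are never consecutive. *)
Lemma edge_face_shared (x : D) : ~~ on_outer x -> ~~ on_outer (edge x) ->
  on_outer (edge (face x)).
Proof.
move=> ox oe; have := outer_corner er dt (edge x); rewrite (negbTE oe) /=.
by rewrite -[node (edge x)]/(face x) (on_outer_face pm) (negbTE ox) -(on_outer_edge pm).
Qed.

Lemma bipartite_face : exists c : D -> bool,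
  (forall x, c (edge x) = ~~ c x) /\
  (forall x, c (face x) = ~~ c x) /\ (forall x, c (node x) = c x).
Proof.
case: er => -[_ _ [c [cv ce]] _] _; exists c.
have e1 x : c (edge x) = ~~ c x by have := ce x; do 2!case: (c _).
have n1 x : c (node x) = c x by rewrite -(cv _ _ (same_vertex1 x)).
by split=> //; split=> // x; rewrite n1 e1.
Qed.

Lemma face_neq (x : D) : face x != x.
Proof.
have [c [_ [cf _]]] := bipartite_face.
by apply/eqP => /(congr1 c); rewrite cf; case: (c x).
Qed.

Lemma face2_neq (x : D) : face (face x) != x.
Proof.
apply/eqP => h; have v : same_vertex x (edge (face x)).
  by rewrite (same_vertex_sym pm) -{2}h; exact: same_vertex1.
have := simple_eq er v; rewrite (edgeK pm) => /(_ (same_vertex1 _)) xE.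
case/negP: (same_face_edge er x); rewrite {2}xE (edgeK pm).
exact: same_face1.
Qed.

Lemma face3_neq (x : D) : face (face (face x)) != x.
Proof.
have [c [_ [cf _]]] := bipartite_face.
by apply/eqP => /(congr1 c); rewrite !cf; case: (c x).
Qed.

End CersCorners.

Lemma chain_cers m : even_ring_chain m -> CERS m.
Proof. by case=> er dp; split=> //; apply: path_dual_is_tree (ers_plane er) dp. Qed.

(** * Labelling an even ring chain *)

Section ChainLabelling.
Variable m : cmap.
Hypothesis ch : even_ring_chain m.
Let cm := chain_cers ch.
Let er := proj1 cm.
Let dt := proj2 cm.
Let pm := ers_plane er.
Local Notation D := (dart m).

(** The resonance graph says nothing about parities at the end faces, so these are made even by the
    choice of the marked darts. *)
Lemma chain_labelled :
  exists n p q, [/\ labelled m n p q, ~~ odd (p 0) & ~~ odd (p n.-1)].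
Proof.
case: ch => _ [s [us s0 alls sadj]].
have [a0 _] : exists a0, a0 \in s by case: s s0 {us alls sadj} => // a s _; exists a; exact: mem_head.
pose n := size s; pose F i := nth a0 s i.
have Finj i j : i < n -> j < n -> same_face (val (F i)) (val (F j)) -> i = j.
  by move=> hi hj; rewrite -inner_face_eq // nth_uniq // => /eqP.
pose pk i := odflt (outer m)
  [pick x | same_face (val (F i)) x && same_face (val (F i.+1)) (edge x)].
have pkP i : i.+1 < n -> same_face (val (F i)) (pk i) /\ same_face (val (F i.+1)) (edge (pk i)).
  move=> hi; rewrite /pk; case: pickP => [x /andP[] //|no].
  have: dual_adj (F i) (F i.+1) by rewrite (sadj _ _ (ltnW hi) hi a0) eqxx orbT.
  by case/dual_adjP=> x [h1 h2 _]; have := no x; rewrite h1 h2.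
(* At either end of the chain the missing dart is put two [face] steps after its partner; the face
   has even length, so both arcs are even. A single face has no shared edge, and [u 0] is then its
   representative. *)
pose u i := if i is j.+1 then edge (pk j) else
  if 1 < n then face (face (pk 0)) else val (F 0).
pose w i := if i.+1 < n then pk i else face (face (u i)).
have ff (x : D) : same_face x (face (face x)) by exact: same_face_trans (same_face1 _) (same_face1 _).
have Fu i : i < n -> same_face (val (F i)) (u i).
  case: i => [|i] hi; last by case: (pkP i hi).
  rewrite /u; case: (ltnP 1 n) => n1; last exact: same_face_refl.
  by case: (pkP 0 n1) => h _; exact: same_face_trans h (ff _).
have Fw i : i < n -> same_face (val (F i)) (w i).
  move=> hi; rewrite /w; case: ifP => [/pkP[]//|_].
  exact: same_face_trans (Fu _ hi) (ff _).
have Fo i : ~~ on_outer (val (F i)) by exact: inner_face_outer.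
have uw i : i < n -> same_face (u i) (w i).
  by move=> hi; rewrite -(same_face_l pm (Fu _ hi)) Fw.
have opp (x y : D) : y = face (face x) -> [/\ x <> y, y <> face x & x <> face y].
  move=> ->; split=> h.
  - by have := face2_neq cm x; rewrite -h eqxx.
  - by have := face_neq cm (face x); rewrite h eqxx.
  - by have := face3_neq cm x; rewrite -h eqxx.
have neq i : i < n -> [/\ u i <> w i, w i <> face (u i) & u i <> face (w i)].
  move=> hi; case: (ltnP i.+1 n) => hi1; last first.
    by apply: opp; rewrite /w ltnNge hi1.
  case: i hi hi1 => [|i] hi hi1.
    by have [] := opp (w 0) (u 0) ltac:(by rewrite /u /w hi1); split=> // /esym.
  have uE : u i.+1 = edge (pk i) by []; have wE : w i.+1 = pk i.+1 by rewrite /w hi1.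
  have [a1 a2] := pkP i hi; have [b1 b2] := pkP i.+1 hi1.
  have o1 : ~~ on_outer (u i.+1) by rewrite uE -(on_outer_same pm a2).
  have o2 : ~~ on_outer (edge (u i.+1)) by rewrite uE (edgeK pm) -(on_outer_same pm a1).
  have o3 : ~~ on_outer (w i.+1) by rewrite wE -(on_outer_same pm b1).
  have o4 : ~~ on_outer (edge (w i.+1)) by rewrite wE -(on_outer_same pm b2).
  split=> h.
  (* The reversal of a dart equal to both [u i.+1] and [w i.+1] would lie on [F i] and on
     [F i.+2]. *)
  - have := Finj i i.+2 (ltn_trans (ltnSn _) hi) hi1.
    rewrite (same_face_l pm a1) (same_face_r pm _ b2) -wE -h uE (edgeK pm).
    by move=> /(_ (same_face_refl _))/eqP; rewrite -addn2 -{1}[i]addn0 eqn_add2l.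
  - by have := edge_face_shared cm o1 o2; rewrite -h (negbTE o4).
  - by have := edge_face_shared cm o3 o4; rewrite -h (negbTE o2).
exists n, (fun i => findex (@face m) (u i) (w i)), (fun i => findex (@face m) (w i) (u i)).
have even_end i : i < n -> i = 0 \/ i.+1 = n -> ~~ odd (findex (@face m) (u i) (w i)).
  move=> hi ends; have [c [_ [cf _]]] := bipartite_face cm.
  have ci k x : c (iter k (@face m) x) = c x (+) odd k.
    by elim: k => [|k IH]; rewrite ?addbF // iterS cf IH /= addbN.
  have cuw : c (w i) = c (u i).
    rewrite /w; case: ifP => hi1; last by rewrite !cf negbK.
    by case: ends hi1 => -> ; [rewrite /u => ->; rewrite !cf negbK | rewrite ltnn].
  have := ci (findex (@face m) (u i) (w i)) (u i).
  by rewrite (iter_findex (uw i hi)) cuw; case: (c _); case: (odd _).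
split; last 2 first.
- by apply: even_end; [exact: s0 | left].
- by apply: even_end; rewrite ?prednK //; right.
exists u, w; split.
- by move=> i hi; rewrite -(on_outer_same pm (Fu _ hi)).
- move=> i j hi hj ij; apply: Finj => //.
  by rewrite (same_face_l pm (Fu _ hi)) (same_face_r pm _ (Fu _ hj)).
- move=> x ox; exists (index (face_of pm ox) s); first by rewrite index_mem.
  rewrite -(same_face_l pm (Fu _ _)) ?index_mem // /F nth_index //.
  by rewrite (same_face_sym pm) same_face_of.
- by move=> i hi; apply/iter_findex/uw.
- by move=> i hi; apply: iter_findex; rewrite -/(same_face _ _) (same_face_sym pm) uw.
- move=> i hi; have [/eqP h _ _] := neq i hi.
  by rewrite findex_addC //; [exact: face_inj | exact: uw].
- move=> i hi; have [h1 h2 h3] := neq i hi.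
  have two (x y : D) : same_face x y -> x <> y -> y <> face x -> 2 <= findex (@face m) x y.
    move=> xy n1 n2; have := iter_findex xy.
    by case: (findex _ x y) => [/n1|[/esym/n2|]].
  split; apply: two => //; first exact: uw.
    by rewrite (same_face_sym pm) uw.
  by move/esym.
- by move=> i hi; rewrite /w hi.
- move=> x ox oe; have ix : face_of pm ox \in s by []; have ie : face_of pm oe \in s by [].
  have adj : dual_adj (face_of pm ox) (face_of pm oe).
    apply: (dual_adjI (x := x)).
    - by rewrite face_of_eq same_face_edge.
    - by rewrite (same_face_sym pm) same_face_of.
    - by rewrite (same_face_sym pm) same_face_of.
  pose i := index (face_of pm ox) s; pose j := index (face_of pm oe) s.
  have hi : i < n by rewrite index_mem. have hj : j < n by rewrite index_mem.
  have Fi : same_face (val (F i)) x by rewrite /F nth_index // (same_face_sym pm) same_face_of.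
  have Fj : same_face (val (F j)) (edge x).
    by rewrite /F nth_index // (same_face_sym pm) same_face_of.
  have := sadj _ _ hi hj a0; rewrite !nth_index // adj => /esym/orP[]/eqP ij.
    exists j; rewrite -?ij //; right; have [h1 h2] := pkP j ltac:(by rewrite -ij).
    rewrite /u ij /= -[x](edgeK pm); congr edge; apply: (shared_edge_uniq er dt); rewrite ?(edgeK pm) //.
      by rewrite -(same_face_l pm Fj).
    by rewrite -(same_face_l pm Fi) ij.
  exists i; rewrite -?ij //; left; have [h1 h2] := pkP i ltac:(by rewrite -ij).
  rewrite /w -ij hj; apply: (shared_edge_uniq er dt) => //.
    by rewrite -(same_face_l pm Fi).
  by rewrite -(same_face_l pm Fj) ij.
Qed.
End ChainLabelling.

(** * Isomorphism of systems with equal labels *)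

Section OuterNodes.
Variable m : cmap.
Hypothesis cm : CERS m.
Let er := proj1 cm.
Let dt := proj2 cm.
Let pm := ers_plane er.
Implicit Types x y : dart m.

(** This lemma and the next compute [node] at the inner corner preceding the outer one from inner
    faces only: here the vertex has one inner corner, there it has two. *)
Lemma node_face_outer x : on_outer (edge x) -> on_outer (edge (face x)) ->
  node (face x) = edge x.
Proof.
move=> o1 o2; apply: (outer_corner_inj er) => //; last by rewrite -(on_outer_edge pm).
rewrite (same_vertex_sym pm); apply: same_vertex_trans (same_vertex1 _) _.
exact: same_vertex1.
Qed.

Lemma node_face_inner x y : ~~ on_outer x -> ~~ on_outer (edge x) -> face y = edge x ->
  on_outer (edge (face x)) -> on_outer (edge y) /\ node (face x) = edge y.
Proof.
move=> ox oe yE o2; have ny : node (edge y) = edge x by rewrite -yE.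
have oy : on_outer (edge y).
  have := outer_corner er dt (edge y); rewrite ny (negbTE oe) -[node (edge x)]/(face x).
  by rewrite (on_outer_face pm) (negbTE ox) !orbF.
split=> //; apply: (outer_corner_inj er) => //; last by rewrite -(on_outer_edge pm).
rewrite (same_vertex_sym pm); apply: same_vertex_trans (same_vertex1 _) _.
by rewrite ny; apply: same_vertex_trans (same_vertex1 _) (same_vertex1 _).
Qed.
End OuterNodes.

(** Sends an inner dart to the dart with the same coordinates, namely the index of its face and its
    number of steps from [u i]. The value on outer darts is a dummy; [label_iso] sends them along
    with their inner reversals. *)
Definition label_map (m m' : cmap) (n : nat) (u : nat -> dart m) (u' : nat -> dart m')
    (x : dart m) : dart m' :=
  if [pick i : 'I_n | same_face (u i) x] is Some i
  then iter (findex (@face m) (u i) x) (@face m') (u' i) else outer m'.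

Section LabelMap.
Variables (m m' : cmap) (n : nat) (u w : nat -> dart m) (u' w' : nat -> dart m').
Variables (p q : nat -> nat).
Hypotheses (pm : plane_map m) (pm' : plane_map m').
Hypotheses (L : chain_label n u w p q) (L' : chain_label n u' w' p q).
Local Notation psi := (label_map n u u').

Lemma label_map_iter i k : i < n ->
  psi (iter k (@face m) (u i)) = iter k (@face m') (u' i).
Proof.
move=> hi; rewrite /label_map; case: pickP => [j ij|no]; last first.
  by have := no (Ordinal hi); rewrite /= /same_face fconnect_iter.
have ji : j = i :> nat.
  apply: (label_inj L) => //; apply: same_face_trans ij _.
  by rewrite (same_face_sym pm) /same_face fconnect_iter.
rewrite ji -(iter_mod_order (face_inj pm)) findex_iter ?ltn_pmod ?order_gt0 //.
by rewrite (label_order L hi) -(label_order L' hi) (iter_mod_order (face_inj pm')).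
Qed.

Lemma label_iterP x : ~~ on_outer x ->
  exists2 i, i < n & exists k, x = iter k (@face m) (u i).
Proof.
case/(label_cover L) => i hi /iter_findex <-; exists i => //; by eexists.
Qed.

Lemma label_map_inner x : ~~ on_outer x -> ~~ on_outer (psi x).
Proof.
case/label_iterP => i hi [k ->]; rewrite label_map_iter //.
have := label_inner L' hi; rewrite (on_outer_same pm' (y := iter k (@face m') (u' i))) //.
exact: fconnect_iter.
Qed.

Lemma label_map_face x : ~~ on_outer x -> psi (face x) = face (psi x).
Proof. by case/label_iterP => i hi [k ->]; rewrite -iterS !label_map_iter. Qed.

Lemma label_map_edge x : ~~ on_outer x -> ~~ on_outer (edge x) ->
  psi (edge x) = edge (psi x).
Proof.
have mu i : i < n -> psi (u i) = u' i by move=> hi; rewrite -[u i]/(iter 0 (@face m) (u i)) label_map_iter.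
have mw i : i < n -> psi (w i) = w' i.
  by move=> hi; rewrite -(label_to L hi) label_map_iter // (label_to L').
move=> h1 h2; case: (label_shared L h1 h2) => i hi [->|->].
  by rewrite (label_link L hi) mu // mw ?(label_link L') // ltnW.
by rewrite -(label_link L hi) (edgeK pm) (label_link L hi) mu // mw -?(label_link L') ?(edgeK pm') // ltnW.
Qed.
End LabelMap.

Section LabelIso.
Variables (m m' : cmap) (n : nat) (u w : nat -> dart m) (u' w' : nat -> dart m').
Variables (p q : nat -> nat).
Hypotheses (cm : CERS m) (cm' : CERS m').
Hypotheses (L : chain_label n u w p q) (L' : chain_label n u' w' p q).
Let er := proj1 cm.
Let pm := ers_plane er.
Let pm' := ers_plane (proj1 cm').

Lemma label_mapK x : ~~ on_outer x -> label_map n u' u (label_map n u u' x) = x.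
Proof.
case/(label_iterP L) => i hi [k ->].
by rewrite (label_map_iter pm pm' L L') // (label_map_iter pm' pm L' L).
Qed.
End LabelIso.

Definition label_iso (m m' : cmap) n (u : nat -> dart m) (u' : nat -> dart m') x :=
  if on_outer x then edge (label_map n u u' (edge x)) else label_map n u u' x.

Section LabelIsomorphism.
Variables (m m' : cmap) (n : nat) (u w : nat -> dart m) (u' w' : nat -> dart m').
Variables (p q : nat -> nat).
Hypotheses (cm : CERS m) (cm' : CERS m').
Hypotheses (L : chain_label n u w p q) (L' : chain_label n u' w' p q).
Let er := proj1 cm.
Let pm := ers_plane er.
Let pm' := ers_plane (proj1 cm').
Local Notation psi := (label_map n u u').
Local Notation phi := (label_iso n u u').

Lemma label_map_edge_outer x : ~~ on_outer x -> on_outer (edge x) ->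
  on_outer (edge (psi x)).
Proof.
move=> h1; apply: contraLR => h2.
have h3 := label_map_inner pm pm' L L' h1.
have := label_map_inner pm' pm L' L h2.
by rewrite (label_map_edge pm' pm L' L h3 h2) (label_mapK cm cm' L L').
Qed.

Lemma label_iso_inner x : ~~ on_outer x -> phi x = psi x.
Proof. by rewrite /label_iso => /negbTE->. Qed.

Lemma label_iso_outer x : on_outer (phi x) = on_outer x.
Proof.
rewrite /label_iso; case: ifP => h.
  by rewrite label_map_edge_outer // ?(edgeK pm) // (on_outer_edgeN er).
by apply/negbTE/(label_map_inner pm pm' L L'); rewrite h.
Qed.

Lemma label_iso_edge x : phi (edge x) = edge (phi x).
Proof.
case: (boolP (on_outer x)) => h.
  by rewrite {2}/label_iso h (edgeK pm') label_iso_inner // (on_outer_edgeN er).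
rewrite (label_iso_inner h) {1}/label_iso; case: ifP => he; first by rewrite (edgeK pm).
by rewrite (label_map_edge pm pm' L L') // he.
Qed.

Lemma label_iso_face x : ~~ on_outer x -> phi (face x) = face (phi x).
Proof.
by move=> h; rewrite !label_iso_inner ?(on_outer_face pm) // (label_map_face pm pm' L L').
Qed.

(* At a vertex, the outer dart is reached from an inner one through inner
   faces only, so a map compatible with inner faces respects [node]. *)
Lemma label_iso_node d : phi (node d) = node (phi d).
Proof.
case: (boolP (on_outer (edge d))) => oe; last first.
  by rewrite -face_edge // label_iso_face // label_iso_edge face_edge.
have od : ~~ on_outer d.
  by apply: contraTN oe => h; apply: (on_outer_edgeN er).
pose x := finv (@face m) d; have xE : face x = d by rewrite f_finv //; exact: face_inj.
have ox : ~~ on_outer x by rewrite -(on_outer_face pm) xE.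
have fx : face (phi x) = phi d by rewrite -label_iso_face // xE.
have oe' : on_outer (edge (face (phi x))).
  by rewrite fx -label_iso_edge label_iso_outer.
rewrite -fx -xE; rewrite -xE in oe.
case: (boolP (on_outer (edge x))) => ex.
  rewrite (node_face_outer cm ex oe) label_iso_edge (node_face_outer cm') //.
  by rewrite -label_iso_edge label_iso_outer.
pose y := finv (@face m) (edge x).
have yE : face y = edge x by rewrite f_finv //; exact: face_inj.
have oy : ~~ on_outer y by rewrite -(on_outer_face pm) yE.
have [_ ->] := node_face_inner cm ox ex yE oe; rewrite label_iso_edge.
have yE' : face (phi y) = edge (phi x) by rewrite -label_iso_face // yE label_iso_edge.
have [||_ ->//] := node_face_inner cm' _ _ yE' oe'; rewrite ?label_iso_outer //.
by rewrite -label_iso_edge label_iso_outer.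
Qed.
End LabelIsomorphism.

Lemma label_isoK m m' n (u w : nat -> dart m) (u' w' : nat -> dart m') p q :
  CERS m -> CERS m' -> chain_label n u w p q -> chain_label n u' w' p q ->
  cancel (label_iso n u u') (label_iso n u' u).
Proof.
move=> cm cm' L L' x; rewrite {1}/label_iso (label_iso_outer cm cm' L L').
have pm' := ers_plane (proj1 cm').
case: (boolP (on_outer x)) => h; last by rewrite label_iso_inner // (label_mapK cm cm' L L').
rewrite -(label_iso_edge cm cm' L L') label_iso_inner ?(on_outer_edgeN (proj1 cm)) //.
rewrite (label_mapK cm cm' L L') ?(on_outer_edgeN (proj1 cm)) //.
by rewrite (edgeK (ers_plane (proj1 cm))).
Qed.

Lemma labelled_iso m m' n p q : CERS m -> CERS m' ->
  labelled m n p q -> labelled m' n p q -> underlying_iso m m'.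
Proof.
move=> cm cm' [u [w L]] [u' [w' L']].
have fK := label_isoK cm cm' L L'; have gK := label_isoK cm' cm L' L.
exists (label_iso n u u'); split; first by exists (label_iso n u' u).
  exact: label_iso_edge cm cm' L L'.
have con m1 m2 (h : dart m1 -> dart m2) : (forall d, h (node d) = node (h d)) ->
    forall d e, same_vertex d e -> same_vertex (h d) (h e).
  move=> hn d e /connectP[r + ->]; elim: r d => [|z r IH] d /=.
    by move=> _; exact: connect0.
  case/andP=> /eqP <- /IH; apply: connect_trans.
  by rewrite hn; exact: fconnect1.
move=> d e; apply/idP/idP => h; last exact: con (label_iso_node cm cm' L L') _ _ h.
rewrite -(fK d) -(fK e); exact: con (label_iso_node cm' cm L' L) _ _ h.
Qed.

(** * Lengthening an arc by two *)

Section SubdivisionOrbits.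
Variables (m : cmap) (d0 : dart m).
Hypotheses (pm : plane_map m) (oe0 : on_outer (edge d0)).
Local Notation N := (subdiv2 d0).
Local Notation old := (@old m d0).

Lemma face_old_inner x : ~~ on_outer x -> x <> d0 -> @face N (old x) = old (face x).
Proof.
by move=> ox /eqP xd; apply: face_old => //; apply: contraNneq ox => ->.
Qed.

Lemma iter_face_old x k : ~~ on_outer x -> (forall j, j < k -> iter j (@face m) x <> d0) ->
  iter k (@face N) (old x) = old (iter k (@face m) x).
Proof.
move=> ox; elim: k => //= k IH h; rewrite IH => [|j jk]; last by apply: h; apply: ltnW.
apply: face_old_inner; last exact: h.
have /(on_outer_same pm) <- // : same_face x (iter k (@face m) x) by exact: fconnect_iter.
Qed.

Lemma iter_face_old_through x k : ~~ on_outer x -> face x = d0 -> 1 < k ->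
  k <= fingraph.order (@face m) x ->
  iter k.+2 (@face N) (old x) = old (iter k (@face m) x).
Proof.
move=> ox xd k1 ko.
have inj i j := @iter_order_inj _ (@face m) x i j.
have ok : forall j, j < fingraph.order (@face m) x -> j <> 1 -> iter j (@face m) x <> d0.
  by move=> j jo j1; rewrite -xd => h; apply: j1; apply: (@inj j 1) => //; lia.
have -> : k.+2 = (k - 2) + 3 + 1 by lia.
have i3 y : iter 3 (@face N) y = @face N (@face N (@face N y)) by [].
have i2 : iter 2 (@face m) x = face d0 by rewrite -xd.
rewrite iterD -[iter 1 _ _]/(@face N (old x)) iterD i3.
rewrite face_old_inner //; last by apply: (ok 0) => //; lia.
rewrite xd face_old_l face_new1 face_new3 // iter_face_old.
- by rewrite -i2 -iterD subnK.
- by rewrite (on_outer_face pm) -xd (on_outer_face pm).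
- by move=> j jk; rewrite -i2 -iterD; apply: ok; lia.
Qed.

Lemma order_face_old x : ~~ on_outer x ->
  fingraph.order (@face N) (old x) = fingraph.order (@face m) x + 2 * same_face x d0.
Proof.
move=> ox; rewrite /fingraph.order card_sum_pred; congr (_ + _).
  by apply: eq_card => y; rewrite !inE -[LHS]/(same_face (old x) (old y)) same_face_under.
have xe : same_face x (edge d0) = false.
  by apply/negbTE; apply: contra ox => h; rewrite (on_outer_same pm h).
rewrite -sum1_card big_mkcond /= !big_ord_recl big_ord0 /= !inE.
have E i : fconnect (@face N) (old x) (inr i) = odd i && same_face x d0.
  rewrite -[LHS]/(same_face (old x) (inr i : dart N)) same_face_under //=.
  by case: (odd i).
by rewrite !E /=; case: (same_face x d0).
Qed.
End SubdivisionOrbits.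

(** The subdivided dart is the one right after [u i]; as [p i] is at least 2 it lies strictly before
    [w i], so its edge is on the outer face and only this arc grows. *)
Lemma labelled_bump m n p q i : CERS m -> labelled m n p q -> i < n ->
  exists2 m1, transformation1 m m1 & labelled m1 n (fun k => p k + 2 * (k == i)) q.
Proof.
move=> cm [u [w L]] hi; have er := proj1 cm; have pm := ers_plane er.
pose d0 := face (u i); have [p2 q2] := label_size L hi.
have oi := label_order L hi.
have inj a b := @iter_order_inj _ (@face m) (u i) a b.
have id0 : same_face (u i) d0 by exact: same_face1.
have od0 : ~~ on_outer d0 by rewrite (on_outer_face pm) (label_inner L).
have d0w : d0 <> w i by rewrite -(label_to L hi) => /(@inj 1 (p i)); lia.
have d0u : d0 <> u i by move=> /(@inj 1 0); lia.
have oe0 : on_outer (edge d0) := label_edge_outer pm L hi id0 d0u d0w.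
have bd : boundary_segment_dart d0 by rewrite /boundary_segment_dart oe0 od0 orbT.
have er1 := subdiv_even_ring er bd.
have same j x : j < n -> same_face (u j) x -> x = d0 -> j = i.
  by move=> hj jx xd; apply: (label_inj L) => //; rewrite (same_face_r pm _ id0) -xd.
have ow j : j < n -> ~~ on_outer (w j).
  by move=> hj; rewrite -(on_outer_same pm (label_face L hj)) (label_inner L).
have fi := face_inj pm.
exists (subdiv2 d0).
  split=> //; first by split=> //; apply: subdiv_dual_tree er (proj2 cm).
  left; exists d0; split=> //; exists id; split=> //; first by exists id.
  exact: same_face_refl.
exists (fun j => old d0 (u j)), (fun j => old d0 (w j)); split.
- by move=> j hj; rewrite on_outer_under // under_old (label_inner L).
- by move=> j k hj hk; rewrite same_face_under // !under_old; apply: label_inj L _ _ hj hk.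
- move=> z; rewrite on_outer_under // => /(label_cover L)[j hj h].
  by exists j; rewrite // same_face_under.
- move=> j hj; rewrite -(label_to L hj); case: (eqVneq j i) => [->|ji].
    rewrite muln1 addn2; apply: iter_face_old_through => //; last by lia.
    exact: (label_inner L).
  rewrite addn0; apply: iter_face_old => //; first exact: (label_inner L).
  move=> k _ kd; case/eqP: ji; apply: same kd => //; exact: fconnect_iter.
- move=> j hj; rewrite -(label_back L hj); apply: iter_face_old => //; first exact: ow.
  move=> k kq kd.
  have ji : j = i.
    apply: same kd => //; apply: same_face_trans (label_face L hj) _.
    exact: fconnect_iter.
  move: kd; rewrite ji -(label_to L hi) -iterD => /(@inj (k + p i) 1); move: kq; rewrite ji; lia.
- move=> j hj; rewrite order_face_old //; last exact: (label_inner L).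
  rewrite (label_order L hj) addnAC; congr (_ + 2 * _ + _); apply: congr1.
  apply/idP/eqP => [h|->//]; exact: same h erefl.
- by move=> j /(label_size L); lia.
- move=> j hj; rewrite edge_old ?(label_link L) //; apply/eqP.
    move=> wd; have := label_inner L hj; rewrite -(label_link L hj) wd oe0 //.
  by move=> wd; have := ow j (ltnW hj); rewrite wd oe0.
- move=> z; rewrite !on_outer_under // under_edge // => h1 h2.
  have [j hj zE] := label_shared L h1 h2.
  have zold : z = old d0 (under z).
    move: z h1 h2 {zE}; apply: subdiv_ind => // ; rewrite under_new //=;
      by rewrite ?(edgeK pm) oe0.
  by exists j => //; rewrite zold; case: zE => ->; [left | right].
Qed.

Lemma labelled_bump_back m n p q i : CERS m -> labelled m n p q -> i < n ->
  exists2 m1, transformation1 m m1 & labelled m1 n p (fun k => q k + 2 * (k == i)).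
Proof.
move=> cm /(labelled_rev (ers_plane (proj1 cm))) L hi.
have hi' : n - i.+1 < n by lia.
have [m1 t L1] := labelled_bump cm L hi'; exists m1 => //.
have pm1 : plane_map m1 by case: t => _ [er1 _] _; exact: ers_plane er1.
apply: labelled_ext (labelled_rev pm1 L1) => k hk /=.
  by congr p; lia.
by congr (q _ + 2 * nat_of_bool _); [lia | apply/eqP/eqP; lia].
Qed.

(** Induction on the total deficit of the arcs: lengthening a deficient arc by two lowers it and
    keeps all deficits even. *)
Lemma labelled_raise m n p q p' q' : CERS m -> labelled m n p q ->
  (forall i, i < n -> p i <= p' i /\ ~~ odd (p' i - p i)) ->
  (forall i, i < n -> q i <= q' i /\ ~~ odd (q' i - q i)) ->
  exists m1, [/\ clos_refl_trans cmap transformation1 m m1, CERS m1 & labelled m1 n p' q'].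
Proof.
have [d] := ubnP (\sum_(i < n) (p' i - p i) + \sum_(i < n) (q' i - q i)).
elim: d m p q => // d IH m p q dm cm L hp hq.
have low (r r' : nat -> nat) : (forall i, i < n -> r i <= r' i /\ ~~ odd (r' i - r i)) ->
   (forall i, i < n -> r i = r' i) \/ exists2 i, i < n & r i + 2 <= r' i.
  move=> hr; case: (pickP (fun i : 'I_n => r i != r' i)) => [i ri|no].
    by right; exists i => //; have := hr i (ltn_ord i); lia.
  by left=> i hi; apply/eqP; have := no (Ordinal hi) => /negbFE.
have dec (r r' : nat -> nat) i : i < n -> r i + 2 <= r' i ->
   \sum_(k < n) (r' k - (r k + 2 * (k == i :> nat))) < \sum_(k < n) (r' k - r k).
  move=> hi ri; rewrite (bigD1 (Ordinal hi)) //= [X in _ < X](bigD1 (Ordinal hi)) //= eqxx.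
  have : \sum_(k < n | k != Ordinal hi) (r' k - (r k + 2 * (k == i :> nat))) =
         \sum_(k < n | k != Ordinal hi) (r' k - r k).
    by apply: eq_bigr => k; rewrite -val_eqE /= => /negbTE->; rewrite muln0 addn0.
  by move=> ->; rewrite ltn_add2r muln1; lia.
have bump (r r' : nat -> nat) i : r i + 2 <= r' i ->
    (forall i, i < n -> r i <= r' i /\ ~~ odd (r' i - r i)) ->
    forall k, k < n -> r k + 2 * (k == i) <= r' k /\ ~~ odd (r' k - (r k + 2 * (k == i))).
  by move=> ri hr k /hr; case: eqP => [->|_]; lia.
have cont m2 : transformation1 m m2 -> forall m1,
    clos_refl_trans cmap transformation1 m2 m1 -> clos_refl_trans cmap transformation1 m m1.
  by move=> t m1; apply: rt_trans; apply: rt_step.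
have [pe|[i hi pi]] := low p p' hp; last first.
  have [m2 t L2] := labelled_bump cm L hi; have [_ c2 _] := t.
  have [||m1 [tm1 c1 L1]] := IH _ _ _ _ c2 L2 _ hq.
  - by have := dec p p' i hi pi; lia.
  - exact: bump.
  - by exists m1; split=> //; apply: cont t _ tm1.
have [qe|[i hi qi]] := low q q' hq; last first.
  have [m2 t L2] := labelled_bump_back cm L hi; have [_ c2 _] := t.
  have [||m1 [tm1 c1 L1]] := IH _ _ _ _ c2 L2 hp.
  - by have := dec q q' i hi qi; lia.
  - exact: bump.
  - by exists m1; split=> //; apply: cont t _ tm1.
by exists m; split=> //; [exact: rt_refl | exact: labelled_ext L].
Qed.

(** Colours alternate along a face, so its length [p i + q i] is even. *)
Lemma labelled_parity m n p q : CERS m -> labelled m n p q ->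
  forall i, i < n -> odd (q i) = odd (p i).
Proof.
move=> cm [u [w L]] i hi; have [c [_ [cf _]]] := bipartite_face cm.
have ci k x : c (iter k (@face m) x) = c x (+) odd k.
  by elim: k => [|k IH]; rewrite ?addbF // iterS cf IH /= addbN.
have := ci (p i + q i) (u i); rewrite addnC iterD (label_to L) // (label_back L) //.
by rewrite oddD; case: (c _); case: (odd _); case: (odd _).
Qed.

Lemma labelled_equivalent m m' n p q p' q' : CERS m -> CERS m' ->
  labelled m n p q -> labelled m' n p' q' ->
  (forall i, i < n -> odd (p i) = odd (p' i)) -> resonantly_equivalent m m'.
Proof.
move=> cm cm' L L' pp.
have qq i : i < n -> odd (q i) = odd (q' i).
  by move=> hi; rewrite (labelled_parity cm L hi) (labelled_parity cm' L' hi) pp.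
have even_max a b : odd a = odd b ->
    [/\ a <= maxn a b, b <= maxn a b, ~~ odd (maxn a b - a) & ~~ odd (maxn a b - b)].
  by move=> ab; rewrite !leq_max !leqnn orbT !oddB ?leq_max ?leqnn ?orbT //;
    case: (leqP a b) => _; rewrite ab addbb.
have [||m1 [t1 c1 L1]] := labelled_raise (p' := fun i => maxn (p i) (p' i))
    (q' := fun i => maxn (q i) (q' i)) cm L.
- by move=> i /pp/even_max[].
- by move=> i /qq/even_max[].
have [||m2 [t2 c2 L2]] := labelled_raise (p' := fun i => maxn (p i) (p' i))
    (q' := fun i => maxn (q i) (q' i)) cm' L'.
- by move=> i /pp/even_max[].
- by move=> i /qq/even_max[].
exists m1, m2; split=> //; exact: labelled_iso c1 c2 L1 L2.
Qed.

(** * Perfect matchings of a chain as zigzag words *)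

Lemma big_addb_odd (T : finType) (P : pred T) (s : T -> bool) :
  \big[addb/false]_(y | P y) s y = odd #|[set y | P y & s y]|.
Proof.
rewrite -sum1dep_card (big_morph odd oddD (erefl _)) big_mkcondr /=.
by apply: eq_bigr => y _; case: (s y).
Qed.

Section CersMatchings.
Variables (m : cmap) (c : dart m -> bool).
Hypothesis cm : CERS m.
Hypotheses (ce : forall x, c (edge x) = ~~ c x) (cn : forall x, c (node x) = c x).
Let er := proj1 cm.
Let dt := proj2 cm.
Let pm := ers_plane er.
Local Notation D := (dart m).
Implicit Types (x y z d : D) (h : D -> bool).

Lemma vertex_card (A : {set D}) x :
  #|[set e in A | same_vertex x e]| =
  (x \in A) + (node x \in A) + ((node (node x) != x) && (node (node x) \in A)).
Proof.
rewrite -sum1dep_card big_mkcondl /= (eq_bigl (fun y => y \in traject (@node m) x (deg x)));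
  last by move=> y; rewrite same_vertexE.
have := orbit_uniq (@node m) x; rewrite /orbit -/(deg x) => un; rewrite -big_uniq //= {un}.
have := iter_deg er x; case: (deg23 er x) => d2; rewrite d2 /= => xE.
  by rewrite xE eqxx /= !big_cons big_nil !addn0; do 2!case: (_ \in A).
have -> : node (node x) != x.
  have := orbit_uniq (@node m) x; rewrite /orbit -/(deg x) d2 /= !inE.
  by case/andP => /norP[_]; rewrite eq_sym.
by rewrite !big_cons big_nil !addn0; do 3!case: (_ \in A).
Qed.

(* Every other edge of the outer face, which is a Hamiltonian cycle. *)
Definition outer_matching d := (on_outer d && c d) || (on_outer (edge d) && c (edge d)).

Definition shifted_matching h : {set D} := [set d | outer_matching d (+) h d (+) h (edge d)].

(* Going around the end of an inner edge, its two inner faces f, f' and the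
   outer face, exactly one of the four values of (h f, h f') is excluded, and
   the bipartition makes both ends of the edge exclude the same one. *)
Lemma shifted_matchingP h : (forall x, h (face x) = h x) ->
  (forall x, on_outer x -> h x = false) ->
  perfect_matching (shifted_matching h) <->
  (forall y, ~~ on_outer y -> ~~ on_outer (edge y) -> fence_pair (c y) (h y) (h (edge y))).
Proof.
move=> hf ho.
have hn y : h (edge y) = h (node y) by rewrite -(face_edge pm y) hf.
have edge_inv d : (edge d \in shifted_matching h) = (d \in shifted_matching h).
  by rewrite !inE /outer_matching (edgeK pm) orbC addbAC.
(* Seen from its outer corner, a vertex of degree 2 is always matched exactly once; at degree 3 this
   depends only on [h] at the two inner corners. *)
have card_outer x : on_outer x ->
   (#|[set e in shifted_matching h | same_vertex x e]| == 1) =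
   (node (node x) == x) || fence_pair (c x) (h (node x)) (h (node (node x))).
  move=> ox; have nox := on_outer_edgeN er ox.
  have inn y : same_vertex x y -> y <> x -> ~~ on_outer y.
    by move=> xy yx; apply/negP => /(outer_corner_inj er xy ox)/esym.
  have iy : ~~ on_outer (node x).
    by apply: inn; [exact: same_vertex1 | apply/eqP; exact: node_neq].
  rewrite vertex_card !inE /outer_matching ox (negbTE nox) (negbTE iy) !hn !(on_outer_edge pm).
  rewrite (ho x) // !ce !cn; case: (eqVneq (node (node x)) x) => [->|zx] /=.
    by rewrite ox (ho x) //; case: (c x); case: (h (node x)).
  have iz : ~~ on_outer (node (node x)).
    apply: inn; last exact/eqP; exact: same_vertex_trans (same_vertex1 _) (same_vertex1 _).
  rewrite (negbTE iz) (node_order3 er zx).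
  rewrite ox (ho x) // /fence_pair.
  by case: (c x); case: (h (node x)); case: (h (node (node x))).
split=> [/perfect_matchingP[_ Mv] y oy oe|H].
  have ow : on_outer (node (node y)).
    have := outer_corner er dt y.
    by rewrite (negbTE oy) -(on_outer_edge pm) (negbTE oe).
  have wy : node (node (node y)) = y.
    by apply: (node_order3 er); apply: contraNneq oy => <-.
  have := card_outer _ ow; rewrite Mv eqxx wy => /esym/orP[/eqP h1|].
    by move: oe; rewrite (on_outer_edge pm) h1 ow.
  by rewrite !cn hn.
apply/perfect_matchingP; split=> // d.
case/existsP: (all_boundary er dt d) => x /andP[dx ox].
have -> : #|[set e in shifted_matching h | same_vertex d e]| =
          #|[set e in shifted_matching h | same_vertex x e]|.
  apply: eq_card => e; rewrite !inE; congr (_ && _).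
  exact: (same_connect (fconnect_sym (node_inj pm)) dx).
apply/eqP; rewrite card_outer //; case: eqP => //= zx.
have iz : ~~ on_outer (node (node x)).
  apply/negP => oz; case: zx; symmetry; apply: (outer_corner_inj er) => //.
  exact: same_vertex_trans (same_vertex1 _) (same_vertex1 _).
have iy : ~~ on_outer (node x).
  apply/negP => oy; have := node_neq er x.
  by rewrite -(outer_corner_inj er (same_vertex1 x) ox oy) eqxx.
by have := H _ iy; rewrite (on_outer_edge pm) hn cn; apply.
Qed.

Lemma coboundary_inj h : (forall x, h (face x) = h x) -> h (outer m) = false ->
  (forall x, h x (+) h (edge x) = false) -> forall x, h x = false.
Proof.
move=> hf ho he x; rewrite -ho; apply: (connected_const_face pm) => // y.
by have := he y; do 2!case: (h _).
Qed.

(** Two perfect matchings differ by an edge set that is even at each vertex, hence a sum of face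
    boundaries by duality; adding a constant makes the set of faces avoid the outer one. *)
Lemma perfect_matching_shift M : perfect_matching M ->
  exists h, [/\ forall x, h (face x) = h x, forall x, on_outer x -> h x = false &
                M = shifted_matching h].
Proof.
move=> /perfect_matchingP[Me Mv].
have M0 : perfect_matching (shifted_matching (fun=> false)).
  by apply/shifted_matchingP => // y _ _; rewrite /fence_pair; case: (c y).
have /perfect_matchingP[Ne Nv] := M0.
pose s x := (x \in M) (+) (x \in shifted_matching (fun=> false)).
have [x|x|h0 [hf hs]] := face_sum_of_vertex_even pm (s := s).
- by rewrite /s Me Ne.
- rewrite big_split /= !big_addb_odd.
  have setE (A : {set D}) : [set y | same_vertex x y & y \in A] = [set e in A | same_vertex x e].
    by apply/setP => y; rewrite !inE andbC.
  by rewrite !setE Mv Nv.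
exists (fun x => h0 x (+) h0 (outer m)); split.
- by move=> x; rewrite hf.
- move=> x ox; have -> : h0 x = h0 (outer m); last by rewrite addbb.
  by symmetry; apply: fconnect_const ox.
- apply/setP => x; have := hs x; rewrite /s !inE.
  by move: (x \in M) (outer_matching x) (h0 x) (h0 (edge x)) (h0 (outer m)) => [] [] [] [] [].
Qed.

Section FenceOfLabels.
Variables (n : nat) (u w : nat -> D) (p q : nat -> nat).
Hypothesis L : chain_label n u w p q.
Local Notation word := {ffun 'I_n -> bool}.
Implicit Types g : word.

Definition face_values g x : bool :=
  if [pick i : 'I_n | same_face (u i) x] is Some i then g i else false.

Lemma face_values_at g (i : 'I_n) x : same_face (u i) x -> face_values g x = g i.
Proof.
move=> ix; rewrite /face_values; case: pickP => [j jx|/(_ i)]; last by rewrite ix.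
congr (g _); apply: ord_inj; apply: (label_inj L) => //.
by rewrite (same_face_r pm _ ix).
Qed.

Lemma face_values_outer g x : on_outer x -> face_values g x = false.
Proof.
move=> ox; rewrite /face_values; case: pickP => // j jx.
by have := label_inner L (ltn_ord j); rewrite (on_outer_same pm jx) ox.
Qed.

Lemma face_values_face g x : face_values g (face x) = face_values g x.
Proof.
rewrite /face_values (eq_pick (Q := fun i : 'I_n => same_face (u i) x)) // => i.
by rewrite -(same_face_r pm _ (same_face1 x)).
Qed.

(** The colour of the dart of f_i on the edge shared with f_(i+1) gives the direction of the
    comparability between these two faces. *)
Let sigma i := c (w i).

Lemma face_values_matching g :
  perfect_matching (shifted_matching (face_values g)) <-> fence_word sigma g.
Proof.
rewrite shifted_matchingP; [|exact: face_values_face|exact: face_values_outer].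
have val_w (i j : 'I_n) : j = i.+1 :> nat ->
   [/\ edge (w i) = u j, face_values g (w i) = g i & face_values g (u j) = g j].
  move=> ji; have hi : i.+1 < n by rewrite -ji.
  split; first by rewrite ji (label_link L).
    by apply: face_values_at; exact: label_face L _ _.
  by apply: face_values_at; exact: same_face_refl.
split=> [H|/fence_wordP H y oy oe].
  apply/fence_wordP => i j ji; have [we gi gj] := val_w i j ji.
  have := H (w i); rewrite we gi gj; apply.
    by rewrite -(on_outer_same pm (label_face L (ltn_ord i))) (label_inner L).
  exact: (label_inner L).
have [i hi yE] := label_shared L oy oe.
have [we gi gj] := val_w (Ordinal (ltnW hi)) (Ordinal hi) erefl.
have := H (Ordinal (ltnW hi)) (Ordinal hi) erefl; rewrite /= in we gi gj *.
case: yE => ->; first by rewrite we gi gj.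
(* Seen from the other dart of the shared edge, the colour is negated and the two values are
   exchanged, so the constraint is the same. *)
have ew : edge (u i.+1) = w i by rewrite -we (edgeK pm).
have cu : c (u i.+1) = ~~ c (w i) by rewrite -we ce.
by rewrite ew cu gi gj /sigma /fence_pair; case: (c _).
Qed.

(** A set of faces without the outer one is determined by its boundary, so an equation between
    matchings becomes one between sets of faces. *)
Lemma shifted_matching_diff g g' k :
  (forall x, k (face x) = k x) -> (forall x, on_outer x -> k x = false) ->
  symdiff (shifted_matching (face_values g)) (shifted_matching (face_values g')) =
    [set x | k x (+) k (edge x)] ->
  forall x, face_values g x (+) face_values g' x = k x.
Proof.
move=> kf ko /setP H x.
suff: face_values g x (+) face_values g' x (+) k x = false.
  by do 2!case: (face_values _ x); case: (k x).
move: x; apply: coboundary_inj => [x||x].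
- by rewrite !face_values_face kf.
- by rewrite !face_values_outer ?ko // /on_outer same_face_refl.
have := H x; rewrite in_symdiff !inE.
by move: (outer_matching x) (face_values g x) (face_values g' x) (k x)
  (face_values g (edge x)) (face_values g' (edge x)) (k (edge x)) => [] [] [] [] [] [] [].
Qed.

Lemma chain_resonance_fence : graph_iso (@fence_adj n sigma) (@res_adj m).
Proof.
have mp (a : fence n sigma) : perfect_matching (shifted_matching (face_values (val a))).
  by apply/face_values_matching/(valP a).
pose F (a : fence n sigma) : res_vertex m := Sub _ (mp a).
have Fval a : val (F a) = shifted_matching (face_values (val a)) by [].
have uval g (i : 'I_n) : face_values g (u i) = g i.
  by apply: face_values_at; exact: same_face_refl.
have inj : injective F.
  move=> a b /(congr1 val); rewrite !Fval => ab; apply/val_inj/ffunP => i.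
  have := @shifted_matching_diff (val a) (val b) (fun=> false) (fun=> erefl) (fun _ _ => erefl).
  rewrite ab => /(_ _ (u i)); rewrite !uval => H.
  suff: val a i (+) val b i = false by do 2!case: (_ i).
  by apply: H; apply/setP => x; rewrite in_symdiff addbb inE.
have surj M : exists a, F a = M.
  have [h [hf ho ME]] := perfect_matching_shift (valP M).
  pose g : word := [ffun i : 'I_n => h (u i)].
  have gh x : face_values g x = h x.
    case: (boolP (on_outer x)) => ox; first by rewrite face_values_outer // ho.
    case: (label_cover L ox) => i hi ix.
    rewrite (@face_values_at g (Ordinal hi)) // ffunE /=; exact: fconnect_const ix.
  have gM : shifted_matching (face_values g) = val M.
    by rewrite ME; apply/setP => x; rewrite !inE !gh.
  have vg : fence_word sigma g by apply/face_values_matching; rewrite gM (valP M).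
  by exists (Sub g vg); apply: val_inj; rewrite Fval.
exists F; split.
  apply: inj_card_bij => //; rewrite -(card_codom inj).
  apply/subset_leq_card/subsetP => M _; apply/codomP.
  by case: (surj M) => a <-; exists a.
move=> a b; apply/res_adjP/eqP => [[f of_ E]|].
  case: (label_cover L of_) => i hi ix.
  have kE : face_edges f = [set x | same_face f x (+) same_face f (edge x)].
    by apply/setP => x; rewrite (in_face_edges er) !inE.
  rewrite kE !Fval in E.
  have D := shifted_matching_diff (k := same_face f) _ _ E.
  rewrite -(hdist_flip1 (val a) (Ordinal hi)); congr hdist.
  apply/ffunP => j; rewrite ffunE -!uval.
  have -> : (j == Ordinal hi) = same_face f (u j).
    rewrite -(same_face_l pm ix) -val_eqE /=; apply/eqP/idP => [->|/(label_inj L)].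
      exact: same_face_refl.
    by move=> h; symmetry; apply: h.
  rewrite -D; [by do 2!case: (face_values _ _)| |].
    by move=> x; rewrite -(same_face_r pm _ (same_face1 x)).
  by move=> x ox; apply: contraNF of_ => fx; rewrite (on_outer_same pm fx).
move/hdist1P => [i bE]; exists (u i); first exact: (label_inner L).
have vE x : face_values (val b) x = face_values (val a) x (+) same_face (u i) x.
  case: (boolP (on_outer x)) => ox.
    rewrite !face_values_outer //; symmetry; apply/negbTE.
    by apply: contraNN (label_inner L (ltn_ord i)) => /(on_outer_same pm) ->.
  case: (label_cover L ox) => k hk kx; rewrite !(@face_values_at _ (Ordinal hk)) // bE ffunE.
  congr (_ (+) _); rewrite (same_face_sym pm) -(same_face_l pm kx) -val_eqE /=.
  by apply/eqP/idP => [->|/(label_inj L)]; [exact: same_face_refl | apply].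
apply/setP => x; rewrite in_symdiff !Fval (in_face_edges er) !inE !vE.
by move: (outer_matching x) (face_values _ x) (same_face _ x) (face_values _ (edge x))
  (same_face _ (edge x)) => [] [] [] [] [].
Qed.

End FenceOfLabels.
End CersMatchings.

(** From [w i] to [w i.+1] there are one reversal and [p i.+1] steps along the face, each changing
    the colour; so the signs agree when [p i.+1] is odd. *)
Lemma labelled_resonance m n p q : CERS m -> labelled m n p q ->
  exists2 s : nat -> bool, graph_iso (@fence_adj n s) (@res_adj m) &
    forall i, i.+1 < n -> (s i == s i.+1) = odd (p i.+1).
Proof.
move=> cm [u [w L]]; have [c [ce [cf cn]]] := bipartite_face cm.
exists (fun i => c (w i)) => [|i hi]; first exact: (chain_resonance_fence cm ce cn L).
have ci k x : c (iter k (@face m) x) = c x (+) odd k.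
  by elim: k => [|k IH]; rewrite ?addbF // iterS cf IH /= addbN.
rewrite -(label_to L hi) ci -(label_link L hi) ce.
by case: (c _); case: (odd _).
Qed.

(** The pattern yields the parities at all middle faces, and both ends are even by the choice of
    labels. If the patterns match in reverse, the second chain is relabelled from its other end,
    which replaces [p'] by [q'], of equal parity. *)
Lemma resonance_equivalent m m' : even_ring_chain m -> even_ring_chain m' ->
  resonance_iso m m' -> resonantly_equivalent m m'.
Proof.
move=> ch ch' iso; have cm := chain_cers ch; have cm' := chain_cers ch'.
have [n [p [q [L p0 pn]]]] := chain_labelled ch.
have [n' [p' [q' [L' p0' pn']]]] := chain_labelled ch'.
have [s sR sp] := labelled_resonance cm L; have [s' sR' sp'] := labelled_resonance cm' L'.
have [] := fence_rigid (graph_iso_trans sR (graph_iso_trans iso (graph_iso_sym sR'))).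
move=> nn; rewrite -{}nn in sR' sp' L' pn'.
case=> types.
  apply: (labelled_equivalent cm cm' L L') => i hi.
  case: i hi => [|i] hi; first by rewrite (negbTE p0) (negbTE p0').
  case: (ltnP i.+2 n) => hi2; first by rewrite -sp // -sp' // types.
  have -> : i.+1 = n.-1 by lia.
  by rewrite (negbTE pn) (negbTE pn').
apply: (labelled_equivalent cm cm' L (labelled_rev (ers_plane (proj1 cm')) L')) => i hi.
rewrite (labelled_parity cm' L'); last lia.
case: i hi => [|i] hi; first by rewrite subn1 (negbTE p0) (negbTE pn').
case: (ltnP i.+2 n) => hi2.
  have -> : n - i.+2 = (n - i.+3).+1 by lia.
  by rewrite -sp // -sp' ?types //; lia.
have -> : i.+1 = n.-1 by lia.
have -> : n - n.-1.+1 = 0 by lia.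
by rewrite (negbTE pn) (negbTE p0').
Qed.

Theorem theorem3p3 (G G' : cmap) :
  even_ring_chain G -> even_ring_chain G' ->
  (resonantly_equivalent G G' <-> resonance_iso G G').
Proof.
move=> cG cG'; split; last exact: resonance_equivalent.
by apply: resonantly_equivalent_resonance; apply: chain_cers.
Qed.
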